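(* Let $s\in(0,1)$, $N>2s$, let $\Omega\subset\mathbb{R}^N$ be a smooth bounded domain, and let $f:\mathbb{R}\to\mathbb{R}$ be continuous and satisfy: $(f_1)$ $f(t)=0$ for $t<0$ and $f(t)>0$ for $t>0$; $(f_2)$ $\lim_{t\to0^+}\frac{f(t)}{t}=0$ and $\lim_{t\to\infty}\frac{f(t)}{t^{p-1}}=0$ for some $2<p<2^*_s=\frac{2N}{N-2s}$; $(f_3)$ $\lim_{t\to\infty}\frac{f(t)}{t}=+\infty$. Then there exists $\varepsilon_0>0$ such that, for every $\varepsilon\in(0,\varepsilon_0)$, if $u_\varepsilon\in H^s_\varepsilon(\Omega)$ is a weak solution of the Neumann problem $$\varepsilon^{2s}(-\Delta)^s u+u=f(u)\ \text{ in }\Omega,\qquad \mathcal{N}_s u=0\ \text{ in }\mathbb{R}^N\setminus\Omega,$$ then $u_\varepsilon\in L^\infty(\Omega)$.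
   Context: $C_{N,s}>0$ denotes the normalization constant of the fractional Laplacian $(-\Delta)^s\phi(x)=C_{N,s}\,\mathrm{P.V.}\int_{\mathbb{R}^N}\frac{\phi(x)-\phi(y)}{|x-y|^{N+2s}}\,dy$, and $\mathcal{N}_su(x)=C_{N,s}\int_\Omega\frac{u(x)-u(y)}{|x-y|^{N+2s}}\,dy$ for $x\in\mathbb{R}^N\setminus\Omega$ is the nonlocal normal derivative. Write $\Omega^c=\mathbb{R}^N\setminus\Omega$ and $(\Omega^c)^2=\Omega^c\times\Omega^c$. For $\varepsilon>0$ set $$\langle u,v\rangle_{\varepsilon,s}=\frac{C_{N,s}\varepsilon^{2s}}{2}\iint_{\mathbb{R}^{2N}\setminus(\Omega^c)^2}\frac{(u(x)-u(y))(v(x)-v(y))}{|x-y|^{N+2s}}\,dx\,dy+\int_\Omega uv\,dx,$$ and let $H^s_\varepsilon(\Omega)$ be the Hilbert space of measurable functions $u:\mathbb{R}^N\to\mathbb{R}$ (modulo equality a.e.) with $\langle u,u\rangle_{\varepsilon,s}<\infty$. A weak solution of the Neumann problem is a function $u\in H^s_\varepsilon(\Omega)$ such that $\langle u,v\rangle_{\varepsilon,s}=\int_\Omega f(u)v\,dx$ for all $v\in H^s_\varepsilon(\Omega)$. *)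

(* Defs.v *)
From HB Require Import structures.
From mathcomp Require Import all_boot all_order all_algebra.
From mathcomp Require Import all_classical all_reals all_analysis.

Set Implicit Arguments.
Unset Strict Implicit.
Unset Printing Implicit Defensive.

Import Order.TTheory GRing.Theory Num.Theory.
Import numFieldNormedType.Exports.

Local Open Scope classical_set_scope.
Local Open Scope ring_scope.

Fact rV_display : measure_display. Proof. exact: default_measure_display. Qed.

Section measurable_rV.
Variables (R : realType) (n : nat).

Let coord (i : 'I_n) (x : 'rV[R]_n) : measurableTypeR R := x 0 i.

Let rV_set0 : g_sigma_preimage coord set0.
Proof. exact: sigma_algebra0. Qed.

Let rV_setC A : g_sigma_preimage coord A -> g_sigma_preimage coord (~` A).
Proof. exact: sigma_algebraC. Qed.

Let rV_bigcup (F : (set 'rV[R]_n)^nat) :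
  (forall i, g_sigma_preimage coord (F i)) ->
  g_sigma_preimage coord (\bigcup_i (F i)).
Proof. exact: sigma_algebra_bigcup. Qed.

(* The sigma-algebra generated by the coordinates, i.e. the Borel sigma-algebra
   of R^n. *)
HB.instance Definition _ := @isMeasurable.Build rV_display
  'rV[R]_n (g_sigma_preimage coord) rV_set0 rV_setC rV_bigcup.

Lemma measurable_coord_rV (i : 'I_n) :
  measurable_fun [set: 'rV[R]_n] (fun x : 'rV[R]_n => x 0 i : measurableTypeR R).
Proof.
move=> _ Y mY; rewrite setTI; apply: sub_sigma_algebra => /=.
rewrite -bigcup_seq/=; exists i => /=; first by rewrite mem_index_enum.
by exists Y => //; rewrite setTI.
Qed.

Lemma measurable_fun_rVP d (T : measurableType d) (f : T -> 'rV[R]_n) :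
  (forall i, measurable_fun [set: T] (fun x => f x 0 i : measurableTypeR R)) ->
  measurable_fun [set: T] f.
Proof.
move=> mf _ Y mY; rewrite setTI.
suff : g_sigma_preimage coord `<=` [set A | measurable (f @^-1` A)] by apply.
apply: smallest_sub.
  split => /=.
  - by rewrite preimage_set0.
  - by move=> A mA; rewrite setTD preimage_setC; exact: measurableC.
  - by move=> F mF; rewrite preimage_bigcup; exact: bigcup_measurable.
rewrite -bigcup_seq; apply: bigcup_sub => i _ _ [A mA <-] /=.
have := mf i measurableT A mA.
by rewrite !setTI.
Qed.

End measurable_rV.

(* Lebesgue measure on R^n = R x R^(n-1), restricted to Borel sets. *)
Fixpoint lebesgueN (R : realType) (n : nat) : set 'rV[R]_n -> \bar R :=
  match n with
  | 0 => @dirac _ 'rV[R]_0 0 R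
  | m.+1 => fun A =>
      (@lebesgue_measure R \x @lebesgueN R m)%E
        [set z | A (row_mx z.1%:M z.2)]
  end.

Section lebesgueN_measure.
Variable R : realType.

Let cons n (z : measurableTypeR R * 'rV[R]_n) : 'rV[R]_n.+1 :=
  row_mx (z.1%:M : 'rV_1) z.2.

Let uncons n (x : 'rV[R]_n.+1) : measurableTypeR R * 'rV[R]_n :=
  (x 0 0, rsubmx (x : 'rV_(1 + n))).

Let cons0 n z : @cons n z 0 0 = z.1.
Proof.
rewrite /cons mxE; case: splitP => // j _.
by rewrite ord1 mxE eqxx mulr1n.
Qed.

Let consS n z (j : 'I_n) : @cons n z 0 (rshift 1 j) = z.2 0 j.
Proof. exact: row_mxEr. Qed.

Let measurable_cons n : measurable_fun setT (@cons n).
Proof.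
apply: measurable_fun_rVP => i.
have [j ->|->] := unliftP 0 i.
- rewrite (_ : (fun x => _) = (fun x : 'rV[R]_n => x 0 j) \o snd).
    exact: (measurableT_comp (measurable_coord_rV j) measurable_snd).
  apply/funext => z /=; rewrite -consS; congr (cons z 0 _).
  exact: val_inj.
- rewrite (_ : (fun x => _) = fst); first exact: measurable_fst.
  by apply/funext => z; rewrite cons0.
Qed.

Let measurable_uncons n : measurable_fun setT (@uncons n).
Proof.
apply: measurable_fun_pair; first exact: measurable_coord_rV.
apply: measurable_fun_rVP => i; under eq_fun do rewrite mxE.
exact: measurable_coord_rV.
Qed.

Let consK n : cancel (@cons n) (@uncons n).
Proof.
move=> [a v]; rewrite /uncons cons0 /=; congr (_, _).
by rewrite /cons row_mxKr.
Qed.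

Section step.
Variables (n : nat) (mu : {sigma_finite_measure set 'rV[R]_n -> \bar R}).

Let nu (A : set 'rV[R]_n.+1) : \bar R :=
  (@lebesgue_measure R \x mu)%E (@cons n @^-1` A).

Let m := [the {measure set _ -> \bar R} of (@lebesgue_measure R \x mu)%E].

Let preimage_cons_measurable A : measurable A -> measurable (@cons n @^-1` A).
Proof. by move=> mA; rewrite -[X in measurable X]setTI; exact: measurable_cons. Qed.

Let nu0 : nu set0 = 0%E. Proof. exact: (@measure0 _ _ _ m). Qed.

Let nu_ge0 A : (0 <= nu A)%E. Proof. exact: (@measure_ge0 _ _ _ m). Qed.

Let nu_sigma_additive : semi_sigma_additive nu.
Proof.
move=> F mF tF mUF; rewrite /nu preimage_bigcup.
apply: (@measure_semi_sigma_additive _ _ _ m).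
- by move=> k; exact: preimage_cons_measurable.
- apply/trivIsetP => /= i j _ _ ij; rewrite -preimage_setI.
  by move/trivIsetP : tF => /(_ _ _ _ _ ij) ->//; rewrite preimage_set0.
- by rewrite -preimage_bigcup; exact: preimage_cons_measurable.
Qed.

HB.instance Definition _ := isMeasure.Build _ _ _ nu
  nu0 nu_ge0 nu_sigma_additive.

Let nu_sigma_finite : sigma_finite setT nu.
Proof.
have /sigma_finiteP[F [TF ndF Foo]] := sigma_finiteT (@lebesgue_measure R).
have /sigma_finiteP[G [TG ndG Goo]] := sigma_finiteT mu.
exists (fun k => @uncons n @^-1` (F k `*` G k)).
  apply/esym; rewrite -subTset => x _.
  have [i _ Fi] : (\bigcup_k F k) (x 0 0) by rewrite -TF.
  have [j _ Gj] : (\bigcup_k G k) (uncons x).2 by rewrite -TG.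
  exists (maxn i j) => //; split.
  - by move: Fi; exact/subsetPset/ndF/leq_maxl.
  - by move: Gj; exact/subsetPset/ndG/leq_maxr.
move=> k; have [mF Fk] := Foo k; have [mG Gk] := Goo k; split.
  rewrite -[X in measurable X]setTI; apply: measurable_uncons => //.
  exact: measurableX.
rewrite /nu (_ : _ @^-1` _ = F k `*` G k); last first.
  by apply/funext => z; exact: (congr1 (F k `*` G k) (consK z)).
by rewrite product_measure1E// lte_mul_pinfty// ge0_fin_numE.
Qed.

HB.instance Definition _ := Measure_isSigmaFinite.Build _ _ _ nu
  nu_sigma_finite.

Definition lebesgueN_step : {sigma_finite_measure set 'rV[R]_n.+1 -> \bar R} :=
  nu.

End step.

Let lebesgueN_sigma_finite_measure n :
  exists mu : {sigma_finite_measure set 'rV[R]_n -> \bar R},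
    @lebesgueN R n = mu :> (set 'rV[R]_n -> \bar R).
Proof.
elim: n => [|n [mu muE]].
  by exists (@dirac _ 'rV[R]_0 0 R).
by exists (lebesgueN_step mu); rewrite /= muE.
Qed.

Variable n : nat.

Let lebesgueN0 : @lebesgueN R n set0 = 0%E.
Proof.
by have [mu ->] := lebesgueN_sigma_finite_measure n; exact: measure0.
Qed.

Let lebesgueN_ge0 A : (0 <= @lebesgueN R n A)%E.
Proof.
by have [mu ->] := lebesgueN_sigma_finite_measure n; exact: measure_ge0.
Qed.

Let lebesgueN_sigma_additive : semi_sigma_additive (@lebesgueN R n).
Proof.
have [mu ->] := lebesgueN_sigma_finite_measure n.
exact: measure_semi_sigma_additive.
Qed.

HB.instance Definition _ := isMeasure.Build _ _ _ (@lebesgueN R n)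
  lebesgueN0 lebesgueN_ge0 lebesgueN_sigma_additive.

Let lebesgueN_sigma_finite : sigma_finite setT (@lebesgueN R n).
Proof.
by have [mu ->] := lebesgueN_sigma_finite_measure n; exact: sigma_finiteT.
Qed.

HB.instance Definition _ := Measure_isSigmaFinite.Build _ _ _ (@lebesgueN R n)
  lebesgueN_sigma_finite.

End lebesgueN_measure.

Section nonlocal_neumann.
Variables (R : realType) (N : nat).
Local Notation leb := (@lebesgueN R N).
Implicit Types (x : 'rV[R]_N) (s eps : R) (Omega : set 'rV[R]_N).
Implicit Types (u v : 'rV[R]_N -> R).

Definition partial (i : 'I_N) (g : 'rV[R]_N -> R) : 'rV[R]_N -> R :=
  fun x => 'D_(delta_mx 0 i) g x.

Definition iter_partial (l : seq 'I_N) (g : 'rV[R]_N -> R) :=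
  foldr partial g l.

Definition Cinfty (g : 'rV[R]_N -> R) :=
  forall l : seq 'I_N, continuous (iter_partial l g) /\
    forall x i, derivable (iter_partial l g) x (delta_mx 0 i).

(* Near each boundary point, Omega lies on one side (the side x_i > gamma if b
   holds, x_i < gamma otherwise) of the graph of a C^oo function gamma of the
   coordinates other than the i-th. *)
Definition smooth_boundary Omega :=
  forall x0, (closure Omega `\` Omega°) x0 ->
  exists (i : 'I_N) (b : bool) (gamma : 'rV[R]_N -> R) (r : R),
    [/\ 0 < r, Cinfty gamma,
        forall x y : 'rV[R]_N, (forall j, j != i -> x 0 j = y 0 j) -> gamma x = gamma y &
        forall x, ball x0 r x ->
          (Omega x <-> if b then gamma x < x 0 i else x 0 i < gamma x)].

Definition smooth_bounded_domain Omega :=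
  [/\ Omega !=set0, open Omega, connected Omega, bounded_set Omega &
      smooth_boundary Omega].

(* The norm of 'rV[R]_N in the library is the max norm. *)
Definition enorm x : R := Num.sqrt (\sum_i x 0 i ^+ 2).

Definition first_coord x : R := \sum_(i < N | i == 0%N :> nat) x 0 i.

(* C_{N,s} = (\int_{R^N} (1 - cos z_1) / |z|^{N+2s} dz)^{-1}, the constant for
   which (-Delta)^s has Fourier symbol |xi|^{2s}. *)
Definition CNs s : R :=
  (fine (\int[leb]_z
     ((1 - cos (first_coord z)) / enorm z `^ (N%:R + 2 * s))%:E)%E)^-1.

(* The quotient is 0 on the diagonal, which is a null set. *)
Definition gagliardo s u v (z : 'rV[R]_N * 'rV[R]_N) : R :=
  (u z.1 - u z.2) * (v z.1 - v z.2) / enorm (z.1 - z.2) `^ (N%:R + 2 * s).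

Definition Hs_prod eps s Omega u v : \bar R :=
  ((CNs s * eps `^ (2 * s) / 2)%:E *
     \int[leb \x leb]_(z in ~` (~` Omega `*` ~` Omega)) (gagliardo s u v z)%:E
   + \int[leb]_(x in Omega) (u x * v x)%:E)%E.

(* Functions rather than their classes modulo equality a.e.: every notion below
   is invariant under modification on a null set, and every class of Lebesgue
   measurable functions has a Borel representative. *)
Definition Hs eps s Omega : set ('rV[R]_N -> R) :=
  [set u | measurable_fun [set: 'rV[R]_N] u /\
           (Hs_prod eps s Omega u u < +oo)%E].

(* The left-hand side is finite by Cauchy-Schwarz, so that the equality in
   \bar R includes the integrability of f(u)v over Omega: an integral whose
   positive and negative parts are both infinite evaluates to -oo. *)
Definition weak_solution eps s Omega (f : R -> R) u :=
  Hs eps s Omega u /\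
  forall v, Hs eps s Omega v ->
    Hs_prod eps s Omega u v = (\int[leb]_(x in Omega) (f (u x) * v x)%:E)%E.

Definition Linfty Omega u :=
  measurable_fun Omega u /\
  (Lnorm leb +oo ((EFin \o u) \_ Omega) < +oo)%E.

End nonlocal_neumann.

(* Main.v *)
(* De Giorgi's method on the measures a(k) = |Omega ∩ {u > k}|.  A smooth
   bounded domain satisfies the corkscrew condition, hence
   |Omega ∩ B_rho(x)| >= c rho^N for x in Omega and rho small.  Choosing rho with
   c rho^N = 2 a(k), every point of Omega ∩ {u > h} sees a mass at least a(k) of
   Omega ∩ {u <= k} at distance O(rho), so that
     (h - k)^2 a(h) <= C a(k)^(2s/N) E
   whenever E is the double integral of [gagliardo s u v] and v = u or v is the
   truncation of (u - k)^+ at height h - k.  With v = u and h = 2k this gives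
   a(k) = O(k^(-q)), q = 2^*_s: the weak form of the Sobolev embedding.  With the
   truncation as test function, E is controlled by the integral of f(u) over
   {u > k}, and since f(t) <= t^(p-1) with p < q, the decay exponent of a
   improves by q - p at each step.  Hence f(u) lies in every L^r over {u > k},
   and the recursion becomes (h - k) a(h) <= C a(k)^(1 + s/N), which forces
   a to vanish at a finite level.  The negative part of u is killed by testing
   with min(u, 0).

   [CNs] is the inverse of a possibly infinite integral, with value 0 in that
   case.  Instead of showing that the integral converges, we treat CNs = 0
   separately: then u = f(u) a.e. in Omega and u is bounded by (f_3). *)
From HB Require Import structures.
From mathcomp Require Import all_boot all_order all_algebra.
From mathcomp Require Import all_classical all_reals all_analysis.
From mathcomp Require Import measurable_realfun ess_sup_inf.
From mathcomp Require Import lra ring.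
(* [Defs] is loaded last: its measure instance on [\x] would otherwise take
   precedence over the library's one for arbitrary factors. *)
Require Import Defs.

Set Implicit Arguments.
Unset Strict Implicit.
Unset Printing Implicit Defensive.

Import Order.TTheory GRing.Theory Num.Theory.
Import numFieldNormedType.Exports.

Local Open Scope classical_set_scope.
Local Open Scope ring_scope.

(** * Borel sets and cubes of R^n *)

Lemma ball_rVE (R : realType) (n : nat) (x : 'rV[R]_n) (r : R) : 0 < r ->
  ball x r = [set y | forall i, `|x 0 i - y 0 i| < r].
Proof.
move=> r0; apply/seteqP; split => y /=.
  by move=> [_ xy] i; exact: xy.
by move=> xy; split => // i j; rewrite ord1; exact: xy.
Qed.

Lemma measurable_ball_rV (R : realType) (n : nat) (x : 'rV[R]_n) (r : R) :
  0 < r -> measurable (ball x r : set 'rV[R]_n).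
Proof.
move=> r0; rewrite ball_rVE//.
rewrite [X in measurable X](_ : _ =
    \bigcap_(i in [set: 'I_n]) 
      ((fun y : 'rV[R]_n => y 0 i : measurableTypeR R) @^-1` ball (x 0 i) r)).
  apply: fin_bigcap_measurable => // i _; rewrite -[X in measurable X]setTI.
  by apply: measurable_coord_rV => //; rewrite ball_itv; exact: measurable_itv.
by apply/seteqP; split => y /= xy i => [_|]; exact: xy.
Qed.

(** Cubes are finite intersections of coordinate preimages of intervals, and an open set is the
    countable union of the cubes inside it with rational centre and radius [k.+1%:R^-1]. *)
Lemma open_measurable_rV (R : realType) (n : nat) (A : set 'rV[R]_n) :
  open A -> measurable A.
Proof.
move=> oA.
pose c (q : 'rV[rat]_n) : 'rV[R]_n := map_mx ratr q.
pose B (q : 'rV[rat]_n * nat) := ball (c q.1) (q.2.+1%:R^-1).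
rewrite (_ : A = \bigcup_(q in [set q | B q `<=` A]) B q).
  rewrite bigcup_mkcond; apply: countable_bigcupT_measurable => // q.
  case: ifPn => // _; apply: measurable_ball_rV.
  by rewrite invr_gt0.
apply/seteqP; split => [x Ax|x [q /= + Bq]]; last exact.
have /nbhs_ballP[e /= e0 eA] : nbhs x A by exact: open_nbhs_nbhs.
(* A cube of radius [k.+1%:R^-1] containing [x] then lies within distance [e] of [x]. *)
pose k := Num.truncn (2 / e).
have ke : 2 * k.+1%:R^-1 < e.
  rewrite ltr_pdivrMr// mulrC -ltr_pdivrMr//.
  exact: Num.Theory.truncnS_gt.
have /all_sig[q xq] : forall i, {q : rat | `|ratr q - x 0 i| < k.+1%:R^-1}.
  move=> i; apply: cid.
  have [q] := @rat_in_itvoo R (x 0 i - k.+1%:R^-1) (x 0 i + k.+1%:R^-1)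
    ltac:(by rewrite ltrD2l gtrN// invr_gt0).
  rewrite in_itv/= => /andP[q1 q2]; exists q.
  by rewrite ltr_distl q1 q2.
exists (\row_i q i, k) => /=; last first.
  by rewrite /B/= ball_rVE ?invr_gt0//= => i; rewrite !mxE.
rewrite /B/= => y; rewrite ball_rVE ?invr_gt0//= => qy.
apply: eA; rewrite ball_rVE//= => i.
rewrite (le_lt_trans _ ke)// mulr_natl mulr2n.
apply: (le_trans (ler_distD (ratr (q i)) _ _)); rewrite lerD// ltW//.
  by rewrite distrC.
by have := qy i; rewrite !mxE.
Qed.

Lemma ball_row_mx (R : realType) (n : nat) (x : 'rV[R]_n.+1) (r a : R)
    (v : 'rV[R]_n) : 0 < r ->
  ball x r (row_mx (a%:M : 'rV_1) v) <->
  ball (x 0 0) r a /\ ball (rsubmx (x : 'rV_(1 + n))) r v.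
Proof.
move=> r0; set y := row_mx _ _.
have y0 : y 0 0 = a.
  by rewrite mxE; case: splitP => // j _; rewrite ord1 mxE eqxx mulr1n.
have yS i : y 0 (rshift 1 i) = v 0 i by exact: row_mxEr.
rewrite !ball_rVE//=; split=> [xy|[xa xv] i].
  split; first by have := xy 0; rewrite y0.
  by move=> i; have := xy (rshift 1 i); rewrite yS mxE.
have [j ->|->] := unliftP 0 i; last by rewrite y0.
have -> : lift 0 j = rshift 1 j by exact: val_inj.
by have := xv j; rewrite yS mxE.
Qed.

(** By induction on [n]: a max-norm ball is the product of an interval and a ball in one dimension
    less. *)
Lemma lebesgueN_ball (R : realType) (n : nat) (x : 'rV[R]_n) (r : R) : 0 < r ->
  lebesgueN (ball x r) = ((2 * r) ^+ n)%:E.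
Proof.
move=> r0; elim: n x => [|n IH] x.
  by rewrite /= diracE mem_set// ball_rVE//= => -[].
have -> : lebesgueN (ball x r) = (@lebesgue_measure R \x @lebesgueN R n)%E
    (ball (x 0 0) r `*` ball (rsubmx (x : 'rV_(1 + n))) r).
  rewrite /=; congr ((_ \x _)%E _); apply/funext => -[a v].
  by apply/propext; exact: ball_row_mx.
rewrite product_measure1E//; last exact: measurable_ball_rV.
  transitivity ((r *+ 2)%:E * ((2 * r) ^+ n)%:E)%E.
    by congr (_ * _)%E; [exact: lebesgue_measure_ball (ltW r0)|exact: IH].
  by rewrite -EFinM exprS mulr_natl.
by rewrite ball_itv; exact: measurable_itv.
Qed.

Lemma bounded_set_fin_measure (R : realType) (n : nat) (A : set 'rV[R]_n) :
  measurable A -> bounded_set A -> (lebesgueN A < +oo)%E.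
Proof.
move=> mA [M [Mr AM]].
(* One unit because [bounded_set] only bounds the norm by numbers above [M], another to land in an
   open ball. *)
pose r := `|M| + 2.
have r0 : 0 < r by rewrite ltr_wpDl.
apply: (@le_lt_trans _ _ (lebesgueN (ball (0 : 'rV[R]_n) r))).
  apply: le_measure; rewrite ?inE//; first exact: measurable_ball_rV.
  move=> x Ax; rewrite mx_norm_ball /ball_/= sub0r normrN.
  apply: (@le_lt_trans _ _ (`|M| + 1)); last by rewrite ltrD2l ltr1n.
  by apply: AM => //; rewrite ltr_pwDr// ler_norm.
by rewrite lebesgueN_ball// ltry.
Qed.

(** * The corkscrew condition for smooth domains *)

Lemma is_derive_line (R : realType) (n : nat) (g : 'rV[R]_n -> R)
    (z v : 'rV[R]_n) (t : R) : derivable g (z + t *: v) v ->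
  is_derive t 1 (fun h => g (z + h *: v)) ('D_v g (z + t *: v)).
Proof.
have E : (fun h => h^-1 *: (((fun h => g (z + h *: v)) \o shift t) (h *: 1) - g (z + t *: v)))
    = (fun h => h^-1 *: ((g \o shift (z + t *: v)) (h *: v) - g (z + t *: v))).
  apply/funext => h /=; congr (_ *: (g _ - _)).
  by rewrite [h *: 1]mulr1 scalerDl addrCA.
by move=> dg; split; rewrite /derivable /derive E.
Qed.

(** Mean value theorem on a segment in direction [i], which stays in the cube by convexity. *)
Lemma partial_lipschitz (R : realType) (n : nat) (g : 'rV[R]_n -> R) (i : 'I_n)
    (x z : 'rV[R]_n) (r M t : R) :
  (forall y, derivable g y (delta_mx 0 i)) -> 0 < r ->
  (forall y, ball x r y -> `|partial i g y| <= M) ->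
  ball x r z -> ball x r (z + t *: delta_mx 0 i) ->
  `|g (z + t *: delta_mx 0 i) - g z| <= M * `|t|.
Proof.
move=> dg r0 gM.
wlog t0 : z t / 0 <= t.
  move=> H xz xzt; have [/H|t0] := leP 0 t; first exact.
  have /= := H (z + t *: delta_mx 0 i) (- t).
  rewrite scaleNr addrK normrN distrC; apply => //.
  by rewrite oppr_ge0 ltW.
move=> xz xzt.
pose df (h : R) := partial i g (z + h *: delta_mx 0 i).
have dE (h : R) : is_derive h 1 (fun h => g (z + h *: delta_mx 0 i)) (df h).
  exact/is_derive_line.
have cE : {within `[0, t], continuous (fun h => g (z + h *: delta_mx 0 i))}.
  apply: continuous_subspaceT => h; apply/differentiable_continuous.
  by apply/derivable1_diffP; have [] := dE h.
have [c] := MVT_segment t0 (fun h _ => dE h) cE.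
rewrite in_itv/= => /andP[c0 ct]; rewrite scale0r addr0 subr0 => ->.
rewrite normrM ler_wpM2r// gM//.
move: xz xzt; rewrite !ball_rVE//= => xz xzt j.
move: (xz j) (xzt j); rewrite !mxE eqxx/=.
have [->|_] := eqVneq j i; last by rewrite !mulr0 addr0.
rewrite !mulr1 !ltr_norml => /andP[? ?] /andP[? ?]; apply/andP; split; lra.
Qed.

(** Continuity bounds all first partial derivatives near [x] by one [M]; then [y] is moved to [z]
    one coordinate at a time. *)
Lemma Cinfty_locally_lipschitz (R : realType) (n : nat) (g : 'rV[R]_n -> R)
    (x : 'rV[R]_n) : Cinfty g ->
  exists2 M : R, 0 <= M & exists2 r : R, 0 < r &
    forall y z : 'rV[R]_n, ball x r y -> ball x r z ->
      `|g z - g y| <= M * \sum_i `|z 0 i - y 0 i|.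
Proof.
move=> gC.
pose M := \sum_i (`|partial i g x| + 1).
have Mi i : `|partial i g x| + 1 <= M.
  by rewrite /M (bigD1 i)//= lerDl sumr_ge0// => j _; rewrite addr_ge0.
have : \forall y \near x, forall i, `|partial i g y| <= M.
  apply: (@filter_forall _ _ (fun i y => `|partial i g y| <= M) _ (nbhs_filter x)) => i.
  have /= := (gC [:: i]).1 x => /cvgr_norm_le; apply.
  by rewrite (lt_le_trans _ (Mi i))// ltrDl.
move=> /nbhs_ballP[r /= r0 rM].
exists M; first by rewrite sumr_ge0// => j _; rewrite addr_ge0.
exists r => // y z xy xz.
(* The first [k] coordinates come from [z], the others from [y]. These points stay in the ball
   because it is a cube. *)
pose w k : 'rV[R]_n := \row_i (if (i < k)%N then z 0 i else y 0 i).
have xw k : ball x r (w k).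
  rewrite ball_rVE// => i; rewrite mxE.
  by move: xy xz; rewrite !ball_rVE//; case: ifP.
have w0 : w 0%N = y by apply/rowP => i; rewrite mxE.
have wn : w n = z by apply/rowP => i; rewrite mxE ltn_ord.
have -> : g z - g y = g (w n) - g (w 0%N) by rewrite w0 wn.
rewrite -(telescope_sumr (fun k => g (w k)))// big_mkord.
apply: (le_trans (ler_norm_sum _ _ _)); rewrite mulr_sumr; apply: ler_sum => i _.
have wS : w i.+1 = w i + (z 0 i - y 0 i) *: delta_mx 0 i.
  apply/rowP => j; rewrite !mxE eqxx/= ltnS leq_eqVlt -val_eqE/=.
  case: (ltngtP j i) => [|ij|/val_inj ->].
  - by rewrite mulr0 addr0.
  - by rewrite mulr0 addr0.
  - by rewrite mulr1 addrCA subrr addr0.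
rewrite wS; apply: (@partial_lipschitz _ _ _ i x (w i) r M) => //.
- by move=> v; have := (gC [::]).2 v i.
- by move=> v xv; exact: rM.
- by rewrite -wS.
Qed.

(* [t] bounds both the scales and the ratio of the cubes: the condition is then
   monotone in [t], as a covering argument over [t --> 0^'+] requires. *)
Definition corkscrew (R : realType) (n : nat) (Omega : set 'rV[R]_n) (t : R) :=
  forall x, Omega x -> forall rho : R, 0 < rho -> rho <= t ->
  exists y, ball y (t * rho) `<=` Omega `&` ball x rho.

(** The small cube is centred at [x] shifted by [rho / 2] along axis [i], towards the side of
    [Omega]. Over it the height of the graph differs from that at [x] by at most [L * (t * rho)],
    and [t * (L + 1) <= 2^-1] keeps the cube on the right side. *)
Lemma corkscrew_at_boundary (R : realType) (n : nat) (Omega : set 'rV[R]_n)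
    (x0 : 'rV[R]_n) (i : 'I_n) (b : bool) (g : 'rV[R]_n -> R) (r : R) :
  0 < r -> Cinfty g ->
  (forall x y : 'rV[R]_n, (forall j, j != i -> x 0 j = y 0 j) -> g x = g y) ->
  (forall x, ball x0 r x ->
     (Omega x <-> if b then g x < x 0 i else x 0 i < g x)) ->
  exists2 t0 : R, 0 < t0 & forall t, 0 < t -> t <= t0 ->
    forall x, ball x0 t0 x -> Omega x -> forall rho, 0 < rho -> rho <= t ->
    exists y, ball y (t * rho) `<=` Omega `&` ball x rho.
Proof.
move=> r0 gC gi OE.
have [M M0 [r' r'0 gM]] := Cinfty_locally_lipschitz x0 gC.
pose L := M * n%:R.
have L0 : 0 <= L by rewrite mulr_ge0.
pose m := Num.min r r'.
have m0 : 0 < m by rewrite lt_min r0.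
pose d := (2 * (L + 1))^-1.
have d0 : 0 < d by rewrite invr_gt0 mulr_gt0// ltr_wpDl.
have dL : d * (L + 1) = 2^-1.
  by rewrite /d invfM -mulrA mulVf ?mulr1// gt_eqF// ltr_wpDl.
exists (Num.min (m / 2) d); first by rewrite lt_min d0 divr_gt0.
move=> t t0; rewrite le_min => /andP[tm td] x x0x Ox rho rho0 rhot.
pose sg : R := if b then 1 else -1.
have xm w : ball x rho w -> ball x0 m w.
  move=> xw; rewrite [m]splitr; apply: ball_triangle.
    by apply: le_ball x0x; rewrite ge_min lexx.
  by apply: le_ball xw; exact: (le_trans rhot).
exists (x + (sg * (rho / 2)) *: delta_mx 0 i) => w.
set y := x + _.
have tL : t * (L + 1) <= 2^-1 by rewrite -dL ler_wpM2r// addr_ge0.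
have tr : t * rho <= rho / 2.
  rewrite mulrC ler_pM2l//; apply: le_trans tL.
  by rewrite ler_peMr ?lerDr// (ltW t0).
move=> [_ /(_ 0) yw0].
have yw j : `|y 0 j - w 0 j| < t * rho by exact: yw0.
have xw : ball x rho w.
  rewrite ball_rVE//= => j; have := yw j; rewrite !mxE eqxx/=.
  have [_|_] := eqVneq j i; rewrite ?mulr1 ?mulr0 ?addr0; last first.
    by move=> /lt_le_trans; apply; apply: (le_trans tr); lra.
  move: tr rho0; rewrite /sg !ltr_norml; case: (b) => ? ? /andP[? ?]; apply/andP; split; lra.
split => //.
(* Since [g] ignores coordinate [i], that coordinate of [w] may be reset to that of [x]. This
   removes the shift by [rho / 2], and all coordinates are within [t * rho] of those of [x]. *)
pose w' := \row_j (if j == i then x 0 j else w 0 j).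
have xw' : ball x rho w'.
  move: xw; rewrite !ball_rVE//= => xw j; rewrite mxE; case: ifPn => // _.
  by rewrite subrr normr0.
have gw : `|g w - g x| <= L * (t * rho).
  have -> : g w = g w' by apply: gi => j ji; rewrite mxE (negbTE ji).
  have rr' : m <= r' by rewrite ge_min lexx orbT.
  apply: (le_trans (gM x w' _ _)).
  - by apply: (le_ball rr'); apply: xm; exact: ballxx.
  - by apply: (le_ball rr'); apply: xm.
  rewrite /L -mulrA ler_wpM2l// mulr_natl -[n in leRHS]card_ord -sumr_const.
  apply: ler_sum => j _; rewrite mxE; case: ifPn => [_|ji].
    by rewrite subrr normr0 mulr_ge0 ?ltW.
  by rewrite distrC ltW//; have := yw j; rewrite !mxE eqxx/= (negbTE ji) mulr0 addr0.
have mr : m <= r by rewrite ge_min lexx.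
apply/OE; first by apply: (le_ball mr); exact: xm.
have /OE : Omega x by [].
have /[swap]/[apply] : ball x0 r x by apply: (le_ball mr); apply: xm; exact: ballxx.
have tLr : L * (t * rho) + t * rho <= rho / 2.
  have -> : L * (t * rho) + t * rho = rho * (t * (L + 1)) by ring.
  by rewrite ler_pM2l.
have := yw i; rewrite !mxE !eqxx/= mulr1.
move: gw tLr; rewrite /sg; case: (b);
  rewrite ler_norml ltr_norml => /andP[? ?] ? /andP[? ?] ?; lra.
Qed.

Lemma bounded_set_closure (R : realType) (n : nat) (A : set 'rV[R]_n) :
  bounded_set A -> bounded_set (closure A).
Proof.
move=> [M [Mr AM]]; exists (M + 2); split; first by rewrite num_real.
move=> K MK x /(_ (ball x 1) (nbhsx_ballx _ _ ltr01))[y [Ay]].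
rewrite mx_norm_ball /ball_/= => xy.
have yK : `|y| <= K - 1 by apply: AM => //; lra.
by have := ler_distD y x 0; rewrite !subr0 => /le_trans; apply; lra.
Qed.

(** Every point of the compact closure has a neighbourhood where the condition holds for all small
    [t]; the near-covering form of compactness makes the smallness of [t] uniform. *)
Lemma smooth_bounded_domain_corkscrew (R : realType) (n : nat)
    (Omega : set 'rV[R]_n) :
  smooth_bounded_domain Omega -> exists2 t : R, 0 < t & corkscrew Omega t.
Proof.
move=> [_ oO _ bO sO].
have : compact (closure Omega).
  apply: bounded_closed_compact; first exact: bounded_set_closure.
  exact: closed_closure.
move=> /compact_near_coveringP/(_ R 0^'+ (fun t x => Omega x -> forall rho : R,
    0 < rho -> rho <= t -> exists y, ball y (t * rho) `<=` Omega `&` ball x rho)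
    _) H.
have {}H : \forall t \near (0:R)^'+, corkscrew Omega t.
  have : \forall t \near (0:R)^'+, closure Omega `<=` (fun x => Omega x ->
    forall rho : R, 0 < rho -> rho <= t ->
    exists y, ball y (t * rho) `<=` Omega `&` ball x rho).
    apply: H => x0 clx0.
    suff [t0 t00 Ht] : exists2 t0 : R, 0 < t0 & forall t, 0 < t -> t <= t0 ->
        forall x, ball x0 t0 x -> Omega x -> forall rho, 0 < rho -> rho <= t ->
        exists y, ball y (t * rho) `<=` Omega `&` ball x rho.
      exists (ball x0 t0, [set t | 0 < t <= t0]).
        split => /=; first exact: nbhsx_ballx.
        by near=> t; apply/andP; split; near: t;
          [exact: nbhs_right_gt|exact: nbhs_right_le].
      by move=> [x t] /= [x0x /andP[? ?]] Ox; exact: Ht.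
    have [Ox0|NOx0] := pselect (Omega° x0); last first.
      have [i [b [g [r [r0 gC gi OE]]]]] := sO x0 (conj clx0 NOx0).
      exact: (@corkscrew_at_boundary _ _ _ x0 i b g r).
    have /nbhs_ballP[r /= r0 rO] := Ox0.
    (* Near an interior point the cube may be centred at [x] itself, as [t <= 1] gives
       [t * rho <= rho]. *)
    exists (Num.min (r / 2) 1); first by rewrite lt_min ltr01 andbT divr_gt0.
    move=> t t0; rewrite le_min => /andP[tr t1] x x0x _ rho rho0 rhot.
    exists x => y xy.
    have xy' : ball x rho y.
      by apply: le_ball xy; rewrite ler_piMl// ltW.
    split => //; apply: rO; rewrite [r]splitr; apply: ball_triangle.
      by apply: le_ball x0x; rewrite ge_min lexx.
    by apply: le_ball xy'; exact: (le_trans rhot).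
  by apply: filterS => t tO x Ox; apply: tO => //; exact: subset_closure.
have [t [t0 tO]] := filter_ex (filterI (nbhs_right_gt (0 : R)) H).
by exists t.
Unshelve. all: by end_near. Qed.

(** * Measurability and measure estimates *)

Lemma measurable_set_ltr d (T : measurableType d) (R : realType) (f g : T -> R) :
  measurable_fun [set: T] f -> measurable_fun [set: T] g ->
  measurable [set x | f x < g x].
Proof.
move=> mf mg.
have mt : measurable [set true] by [].
have := measurable_fun_ltr mf mg measurableT mt.
by rewrite setTI.
Qed.

Lemma measurable_set_ler d (T : measurableType d) (R : realType) (f g : T -> R) :
  measurable_fun [set: T] f -> measurable_fun [set: T] g ->
  measurable [set x | f x <= g x].
Proof.
by move=> mf mg; rewrite -[X in measurable X]setTI; exact: measurable_fun_le.
Qed.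

(** Markov's inequality, the lower bound being required only on a subset [A] of the domain of
    integration. *)
Lemma ge0_cst_le_integral d (T : measurableType d) (R : realType)
    (mu : {measure set T -> \bar R}) (A D : set T) (f : T -> \bar R) (c : R) :
  measurable A -> measurable D -> A `<=` D -> measurable_fun D f ->
  (forall x, D x -> (0 <= f x)%E) -> 0 <= c ->
  (forall x, A x -> (c%:E <= f x)%E) ->
  (c%:E * mu A <= \int[mu]_(x in D) f x)%E.
Proof.
move=> mA mD AD mf f0 c0 cf.
rewrite -(integral_cst mu mA c%:E).
apply: (@le_trans _ _ (\int[mu]_(x in A) f x)%E).
  apply: ge0_le_integral => //.
  - exact: measurable_funS mf.
exact: ge0_subset_integral.
Qed.

Lemma measurable_enorm (R : realType) (n : nat) :
  measurable_fun [set: 'rV[R]_n] (@enorm R n).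
Proof.
apply: (@measurableT_comp _ _ _ _ _ _ (@Num.sqrt R)).
  by apply: continuous_measurable_fun; exact: sqrt_continuous.
apply: measurable_sum => i; apply: measurable_funX.
exact: measurable_coord_rV.
Qed.

Lemma measurable_sub_rV (R : realType) (n : nat) :
  measurable_fun setT (fun z : 'rV[R]_n * 'rV[R]_n => z.1 - z.2).
Proof.
apply: measurable_fun_rVP => i; under eq_fun do rewrite !mxE.
apply: measurable_funB.
  exact: (measurableT_comp (measurable_coord_rV i) measurable_fst).
exact: (measurableT_comp (measurable_coord_rV i) measurable_snd).
Qed.

Lemma measurable_gagliardo (R : realType) (n : nat) (s : R) (u v : 'rV[R]_n -> R) :
  measurable_fun setT u -> measurable_fun setT v ->
  measurable_fun setT (gagliardo s u v).
Proof.
move=> mu mv; rewrite /gagliardo.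
under eq_fun do rewrite -powRN.
apply: measurable_funM; last first.
  apply: (@measurableT_comp _ _ _ _ _ _ (@powR R ^~ _)).
    exact: measurable_powR.
  exact: measurableT_comp (@measurable_enorm R n) (@measurable_sub_rV R n).
by apply: measurable_funM; apply: measurable_funB;
  solve[exact: measurableT_comp measurable_fst|exact: measurableT_comp measurable_snd].
Qed.

(** The crude factor [n], instead of its square root, only enters the constant of
    [level_set_energy]. *)
Lemma enorm_le (R : realType) (n : nat) (x : 'rV[R]_n) (r : R) :
  (forall i, `|x 0 i| <= r) -> 0 <= r -> enorm x <= n%:R * r.
Proof.
move=> xr r0; rewrite /enorm -[leRHS]ger0_norm ?mulr_ge0// -sqrtr_sqr.
rewrite ler_wsqrtr//.
apply: (@le_trans _ _ (n%:R * r ^+ 2)).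
  rewrite mulr_natl -[n in leRHS]card_ord -sumr_const; apply: ler_sum => i _.
  by rewrite -real_normK ?num_real// lerXn2r// nnegrE.
rewrite exprMn ler_wpM2r ?sqr_ge0//.
case: (n) => [|m]; first by rewrite expr0n.
by rewrite expr2 ler_peMl// ler1n.
Qed.

Lemma enorm_gt0 (R : realType) (n : nat) (x : 'rV[R]_n) : x != 0 -> 0 < enorm x.
Proof.
move=> /rV0Pn[i xi]; rewrite /enorm sqrtr_gt0 (bigD1 i)//=.
by rewrite ltr_pwDl ?sumr_ge0 ?exprn_even_gt0// => j _; rewrite sqr_ge0.
Qed.

(** The corkscrew cube has side [2 * (t * rho)]. *)
Lemma corkscrew_measure_ge (R : realType) (n : nat) (Omega : set 'rV[R]_n)
    (t : R) (x : 'rV[R]_n) (rho : R) :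
  measurable Omega -> 0 < t -> corkscrew Omega t -> Omega x ->
  0 < rho -> rho <= t ->
  (((2 * t) ^+ n * rho ^+ n)%:E <= lebesgueN (Omega `&` ball x rho))%E.
Proof.
move=> mO t0 cO Ox rho0 rhot.
have [y yO] := cO x Ox rho rho0 rhot.
rewrite -exprMn -mulrA -(lebesgueN_ball y) ?mulr_gt0//.
apply: le_measure => //; rewrite inE.
  by apply: measurable_ball_rV; rewrite mulr_gt0.
by apply: measurableI => //; exact: measurable_ball_rV.
Qed.

Lemma measurable_powR_EFin d (T : measurableType d) (R : realType) (D : set T)
    (g : T -> R) (p : R) : measurable_fun setT g ->
  measurable_fun D (fun x => (g x `^ p)%:E).
Proof.
move=> mg; apply/measurable_EFinP/measurable_funTS.
by apply: (@measurableT_comp _ _ _ _ _ _ (@powR R ^~ p)) => //; exact: measurable_powR.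
Qed.

(** * Energy of superlevel sets *)

Definition superlevel (R : realType) (n : nat) (Omega : set 'rV[R]_n)
    (u : 'rV[R]_n -> R) (k : R) : set 'rV[R]_n := Omega `&` [set x | k < u x].

Lemma measurable_superlevel (R : realType) (n : nat) (Omega : set 'rV[R]_n)
    (u : 'rV[R]_n -> R) (k : R) : measurable Omega ->
  measurable_fun setT u -> measurable (superlevel Omega u k).
Proof.
by move=> mO mu; apply: measurableI => //; exact: measurable_set_ltr.
Qed.

Lemma superlevel_sub (R : realType) (n : nat) (Omega : set 'rV[R]_n)
    (u : 'rV[R]_n -> R) (k h : R) : k <= h ->
  superlevel Omega u h `<=` superlevel Omega u k.
Proof. by move=> kh x [Ox /= hu]; split => //=; exact: le_lt_trans hu. Qed.

(** [G] is abstract so that one estimate serves both [gagliardo s u u] and its variant with a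
    truncation of [u]; [C] and [m0] depend on neither [u], [G] nor the levels. The integral of [G]
    is bounded below on the set [S] of pairs at max-norm distance less than [rho], one point above
    level [h] and the other not above level [k]. *)
Lemma level_set_energy (R : realType) (n : nat) (s t : R)
    (Omega : set 'rV[R]_n) : (0 < n)%N -> 0 < s -> 0 < t ->
  measurable Omega -> corkscrew Omega t ->
  exists2 C : R, 0 < C & exists2 m0 : R, 0 < m0 &
  forall (u : 'rV[R]_n -> R) (G : 'rV[R]_n * 'rV[R]_n -> R) (k h a : R),
  measurable_fun setT u -> measurable_fun setT G -> (forall z, 0 <= G z) ->
  (forall x y, h < u x -> u y <= k ->
     (h - k) ^+ 2 / enorm (x - y) `^ (n%:R + 2 * s) <= G (x, y)) ->
  k < h -> lebesgueN (superlevel Omega u k) = a%:E -> a <= m0 ->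
  (((h - k) ^+ 2)%:E * lebesgueN (superlevel Omega u h) <=
   (C * a `^ (2 * s / n%:R))%:E *
   \int[@lebesgueN R n \x @lebesgueN R n]_(z in ~` (~` Omega `*` ~` Omega))
      (G z)%:E)%E.
Proof.
move=> n0 s0 t0 mO cO.
have nR0 : 0 < n%:R :> R by rewrite ltr0n.
pose e : R := n%:R + 2 * s.
have e0 : 0 < e by rewrite addr_gt0// mulr_gt0.
pose c0 : R := (2 * t) ^+ n.
have c00 : 0 < c0 by rewrite exprn_gt0// mulr_gt0.
pose th := 2 * s / n%:R.
have th0 : 0 < th by rewrite divr_gt0// mulr_gt0.
(* This constant makes (n rho)^e / a equal to C a^th for the radius [rho] chosen below, as [CE]
   checks. *)
exists (n%:R `^ e * (2 / c0) `^ (1 + th)).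
  by rewrite mulr_gt0// powR_gt0// divr_gt0.
(* With this [m0], the bound [a <= m0] yields [rho <= t], the range of the corkscrew condition. *)
exists (c0 * t ^+ n / 2); first by rewrite divr_gt0// mulr_gt0// exprn_gt0.
move=> u G k h a mu mG G0 Guk kh aE am.
set D := ~` (~` Omega `*` ~` Omega).
have mD : measurable D.
  by apply: measurableC; apply: measurableX; exact: measurableC.
have mE : measurable_fun D (fun z => (G z)%:E).
  by apply/measurable_EFinP; exact: measurable_funTS.
have ID : (0 <= \int[@lebesgueN R n \x @lebesgueN R n]_(z in D) (G z)%:E)%E.
  by apply: integral_ge0 => z _; rewrite lee_fin.
have mA c : measurable (superlevel Omega u c) by exact: measurable_superlevel.
have a_ge0 : 0 <= a by rewrite -lee_fin -aE.
(* The case of measure zero is treated apart, since [rho] would vanish. *)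
have [a0|a0] := leP a 0.
  have -> : lebesgueN (superlevel Omega u h) = 0%E.
    apply/eqP; rewrite eq_le measure_ge0 andbT.
    apply: (@le_trans _ _ (lebesgueN (superlevel Omega u k))).
      by apply: le_measure; rewrite ?inE//; apply: superlevel_sub; exact: ltW.
    by rewrite aE lee_fin.
  by rewrite mule0 mule_ge0// lee_fin mulr_ge0// ?powR_ge0// mulr_ge0// powR_ge0.
pose rho : R := (2 * a / c0) `^ n%:R^-1.
have rho0 : 0 < rho by rewrite powR_gt0// divr_gt0// mulr_gt0.
have rhon : c0 * rho ^+ n = 2 * a.
  rewrite -powR_mulrn ?ltW// /rho -powRrM mulVf ?gt_eqF//.
  by rewrite powRr1 ?divr_ge0 ?mulr_ge0 ?(ltW c00)// mulrC divfK// gt_eqF.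
have rhot : rho <= t.
  rewrite -(@ler_pXn2r _ n) ?nnegrE ?(ltW rho0) ?(ltW t0)//.
  by rewrite -(ler_pM2l c00) rhon; lra.
(* The cube holds mass at least [2 * a] of [Omega], of which the superlevel set removes at most
   [a]. *)
have slice x : Omega x ->
    (a%:E <= lebesgueN ((Omega `&` ball x rho) `\` superlevel Omega u k))%E.
  move=> Ox; set X := _ `\` _.
  have mB : measurable (Omega `&` ball x rho).
    by apply: measurableI => //; exact: measurable_ball_rV.
  have mX : measurable X by exact: measurableD.
  have : ((2 * a)%:E <= lebesgueN X + a%:E)%E.
    rewrite -rhon -aE; apply: (le_trans (corkscrew_measure_ge mO t0 cO Ox rho0 rhot)).
    apply: le_trans (measureU2 _ mX (mA k)) => //.
    apply: le_measure; rewrite ?inE//; first exact: measurableU.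
    move=> y By; have [uy|uy] := pselect (superlevel Omega u k y); first by right.
    by left.
  case: (lebesgueN X) => [r| |]; rewrite ?leey// -EFinD !lee_fin; lra.
pose S := [set z : 'rV[R]_n * 'rV[R]_n | superlevel Omega u h z.1 /\
  ((Omega `&` ball z.1 rho) `\` superlevel Omega u k) z.2].
have mS : measurable S.
  rewrite (_ : S = (superlevel Omega u h `*` (Omega `\` superlevel Omega u k)) `&`
      \bigcap_(i in [set: 'I_n]) [set z : 'rV[R]_n * 'rV[R]_n | `|z.1 0 i - z.2 0 i| < rho]).
    apply: measurableI; first by apply: measurableX => //; exact: measurableD.
    apply: fin_bigcap_measurable => // i _; apply: measurable_set_ltr => //.
    apply: measurableT_comp => //; apply: measurable_funB.
      exact: (measurableT_comp (measurable_coord_rV i) measurable_fst).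
    exact: (measurableT_comp (measurable_coord_rV i) measurable_snd).
  apply/seteqP; split => -[x y] /=.
    move=> [hx [[Oy xy] ky]]; split; first by [].
    by move=> i _; case: xy => _ /(_ 0 i) xyi; exact: xyi.
  move=> [[hx [Oy ky]] xy]; split; [by []|split; [split; [by []|]|by []]].
  split; first by [].
  by move=> i j; rewrite ord1; exact: xy.
have SD : S `<=` D by move=> [x y] [[/= Ox _] _] [].
pose K := (h - k) ^+ 2 / (n%:R * rho) `^ e.
have K0 : 0 <= K by rewrite divr_ge0 ?sqr_ge0 ?powR_ge0.
have KG z : S z -> (K%:E <= (G z)%:E)%E.
  case: z => x y /= [[Ox /= hx] [[Oy xy] kuy]].
  have uy : u y <= k by rewrite leNgt; apply/negP => uy; apply: kuy.
  rewrite lee_fin; apply: le_trans (Guk x y hx uy).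
  rewrite /K ler_wpM2l ?sqr_ge0// -/e lef_pV2 ?posrE ?powR_gt0 ?mulr_gt0//; last first.
    (* The two points differ because [u] exceeds [h] at one and is at most [k < h] at the other. *)
    apply: enorm_gt0; rewrite subr_eq0; apply/eqP => xyE.
    by have := lt_trans kh hx; rewrite xyE ltNge uy.
  apply: ge0_ler_powR; rewrite ?nnegrE ?(ltW e0) ?sqrtr_ge0 ?mulr_ge0 ?(ltW rho0)//.
  apply: enorm_le; last exact: ltW.
  by move=> i; rewrite !mxE; apply: ltW; case: xy => _ /(_ 0 i) xyi; exact: xyi.
have := @ge0_cst_le_integral _ _ _ (@lebesgueN R n \x @lebesgueN R n)%E
  S D _ K mS mD SD mE (fun z _ => G0 z) K0 KG.
(* The product measure integrates the measures of the sections of [S]; those over the superlevel set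
   of [h] are at least [a] by [slice]. *)
have Sa : (a%:E * lebesgueN (superlevel Omega u h) <=
    (@lebesgueN R n \x @lebesgueN R n) S)%E.
  rewrite /product_measure1.
  apply: ge0_cst_le_integral => //.
  - exact: measurable_fun_xsection.
  - move=> x [Ox hx] /=.
    rewrite (_ : xsection S x = (Omega `&` ball x rho) `\` superlevel Omega u k).
      exact: slice.
    apply/seteqP; split => y; rewrite /xsection/= inE.
      by move=> [].
    by [].
move=> /(le_trans (lee_wpmul2l _ Sa)) H.
have P0 : 0 < (n%:R * rho) `^ e by rewrite powR_gt0// mulr_gt0.
have CE : n%:R `^ e * (2 / c0) `^ (1 + th) * a `^ th = (n%:R * rho) `^ e / a.
  have eE : n%:R^-1 * e = 1 + th by rewrite /e /th mulrDr mulVf ?gt_eqF// mulrC.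
  rewrite powRM ?(ltW rho0)// /rho -[(_ `^ _) `^ e]powRrM eE.
  rewrite (_ : 2 * a / c0 = 2 / c0 * a); last by rewrite mulrAC.
  rewrite [(2 / c0 * a) `^ _]powRM ?divr_ge0 ?(ltW c00)// -!mulrA.
  do 2!congr (_ * _).
  rewrite powRD ?gt_eqF ?addr_gt0// powRr1 ?(ltW a0)//.
  by rewrite mulrAC divff ?mul1r// gt_eqF.
rewrite CE.
have -> : (((h - k) ^+ 2)%:E = ((n%:R * rho) `^ e / a)%:E * (K%:E * a%:E))%E.
  rewrite -!EFinM; congr (_%:E); rewrite /K; field.
  by rewrite !gt_eqF.
rewrite -!muleA lee_wpmul2l//; first by rewrite lee_fin divr_ge0// ltW.
by apply: H; rewrite lee_fin.
Qed.

(** * Nonlinear recursions *)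

Lemma gt1_powR_lt1 (R : realType) (x y : R) : 1 < x -> y < 0 -> x `^ y < 1.
Proof.
move=> x1 y0; rewrite /powR gt_eqF ?(lt_trans ltr01)//.
by rewrite expR_lt1 pmulr_llt0// ln_gt0.
Qed.

Lemma powR_exprn (R : realType) (x y : R) (n : nat) : 0 <= x ->
  (x ^+ n) `^ y = (x `^ y) ^+ n.
Proof. by move=> x0; rewrite -!powR_mulrn ?powR_ge0// powRAC. Qed.

Section sequences.
Variable R : realType.
Implicit Types (a : nat -> R) (C M b th al : R).

(** Re-indexing costs a factor 1/b, and the initial term enters the constant through a maximum. *)
Lemma geometric_decay_shift a C b : 0 < b -> 0 <= C ->
  (forall j, a j.+1 <= C * b ^+ j) ->
  exists2 M, 0 <= M & forall j, a j <= M * b ^+ j.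
Proof.
move=> b0 C0 aC; exists (Num.max `|a 0%N| (C / b)).
  by rewrite le_max normr_ge0.
case=> [|j]; first by rewrite expr0 mulr1 le_max ler_norm.
apply: (le_trans (aC j)).
have -> : C * b ^+ j = C / b * b ^+ j.+1.
  by rewrite exprS mulrA divfK// gt_eqF.
by rewrite ler_wpM2r ?exprn_ge0 ?(ltW b0)// le_max lexx orbT.
Qed.

(** The ratio b = 2^(-2/(1-th)) solves b = 2^(-2) b^th, so the bound M b^j reproduces itself once C
    M^th <= M b. *)
Lemma sublinear_recursion_decay a C th : 0 < th -> th < 1 -> 0 <= C ->
  (forall j, 0 <= a j) ->
  (forall j, a j.+1 <= C * (2 `^ (- 2)) ^+ j * a j `^ th) ->
  exists2 M, 0 <= M & forall j, a j <= M * (2 `^ (- (2 / (1 - th)))) ^+ j.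
Proof.
move=> th0 th1 C0 a0 aC.
set b := 2 `^ (- _).
have b0 : 0 < b by rewrite powR_gt0.
have t1 : 0 < 1 - th by rewrite subr_gt0.
have bE : 2 `^ (- 2) * b `^ th = b.
  rewrite /b -powRrM -powRD; last by rewrite pnatr_eq0 implybT.
  by congr (_ `^ _); field; rewrite gt_eqF.
(* The first entry starts the induction, the second gives M^(1-th) >= C/b, which is what the
   inductive step requires. *)
pose M := Num.max (a 0%N) ((C / b) `^ (1 - th)^-1).
have M0 : 0 <= M by rewrite le_max a0.
have MC : C / b <= M `^ (1 - th).
  apply: (@le_trans _ _ (((C / b) `^ (1 - th)^-1) `^ (1 - th))).
    by rewrite -powRrM mulVf ?gt_eqF// powRr1// divr_ge0// ltW.
  apply: ge0_ler_powR; rewrite ?nnegrE ?powR_ge0 ?(ltW t1)//.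
  by rewrite /M le_max lexx orbT.
have CM : C * M `^ th <= M * b.
  have [->|Mn0] := eqVneq M 0.
    rewrite powR0 ?gt_eqF// mulr0 mul0r//.
  apply: (@le_trans _ _ (M `^ th * M `^ (1 - th) * b)); last first.
    by rewrite -powRD ?Mn0 ?implybT// addrC subrK powRr1.
  by rewrite mulrC -mulrA ler_wpM2l ?powR_ge0// -ler_pdivrMr.
exists M => //; elim=> [|j IH]; first by rewrite expr0 mulr1 le_max lexx.
apply: (le_trans (aC j)).
apply: (@le_trans _ _ (C * (2 `^ (- 2)) ^+ j * (M `^ th * (b `^ th) ^+ j))).
  rewrite ler_wpM2l ?mulr_ge0 ?exprn_ge0 ?powR_ge0//.
  rewrite -powR_exprn ?(ltW b0)// -powRM ?exprn_ge0 ?(ltW b0)//.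
  by apply: ge0_ler_powR; rewrite ?nnegrE ?(ltW th0)// mulr_ge0 ?exprn_ge0 ?(ltW b0).
have -> : C * (2 `^ (- 2)) ^+ j * (M `^ th * (b `^ th) ^+ j) = C * M `^ th * b ^+ j.
  by rewrite -[in RHS]bE exprMn; ring.
by rewrite exprS mulrA ler_wpM2r// exprn_ge0// ltW.
Qed.

(** Along the levels [k n], which increase to [K + D], one has [a (k n) <= a K * la ^+ n]: the extra
    power [sg] contributes (la^n)^sg = 2^(-n), which compensates the shrinking gaps between levels.
    Monotonicity then bounds [a (K + D)] by every term. *)
Lemma stampacchia (a : R -> R) K C sg : 0 < sg -> 0 <= C ->
  (forall k, 0 <= a k) -> (forall k h, k <= h -> a h <= a k) ->
  (forall k h, K <= k -> k < h -> (h - k) * a h <= C * a k `^ (1 + sg)) ->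
  exists T, a T = 0.
Proof.
move=> sg0 C0 a0 anon aC.
pose la : R := 2 `^ (- sg^-1).
have la0 : 0 < la by rewrite powR_gt0.
have la1 : la < 1.
  by apply: gt1_powR_lt1; rewrite ?ltr1n// oppr_lt0 invr_gt0.
have laE : la `^ sg = 2^-1.
  by rewrite /la -powRrM mulNr mulVf ?gt_eqF// powR_inv1.
(* The induction closes when D la / 2 >= C a(K)^sg; the added 1 keeps [D] positive even if the first
   term is 0. *)
pose D := 2 * C * a K `^ sg / la + 1.
have D0 : 0 < D.
  by rewrite ltr_pwDr// divr_ge0 ?(ltW la0)// !mulr_ge0 ?powR_ge0.
pose k n := K + D * (1 - 2^-1 ^+ n).
have h0 n : 0 < 2^-1 ^+ n :> R by rewrite exprn_gt0// invr_gt0.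
have kS n : k n.+1 - k n = D * 2^-1 ^+ n.+1.
  by rewrite /k exprS; field.
have ak n : a (k n) <= a K * la ^+ n.
  elim: n => [|n IH]; first by rewrite /k expr0 subrr mulr0 addr0 mulr1.
  have := aC (k n) (k n.+1) _ _.
  rewrite kS => /(_ _ _)/le_trans H.
  have kK : K <= k n.
    by rewrite /k lerDl mulr_ge0 ?(ltW D0)// subr_ge0 exprn_ile1// ?invf_le1// ler1n.
  have kk : k n < k n.+1 by rewrite -subr_gt0 kS mulr_gt0.
  have P : 0 < D * 2^-1 ^+ n.+1 by rewrite mulr_gt0.
  rewrite -(ler_pM2l P); apply: H => //.
  apply: (@le_trans _ _ (C * (a K `^ (1 + sg) * (la ^+ n * 2^-1 ^+ n)))).
    rewrite ler_wpM2l//.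
    have -> : la ^+ n * 2^-1 ^+ n = (la ^+ n) `^ (1 + sg).
      rewrite powRD; last by rewrite gt_eqF ?addr_gt0.
      rewrite powRr1 ?exprn_ge0 ?(ltW la0)//; congr (_ * _).
      by rewrite -laE powR_exprn// ltW.
    rewrite -powRM ?exprn_ge0 ?(ltW la0)//.
    apply: ge0_ler_powR; rewrite ?nnegrE ?addr_ge0 ?(ltW sg0)//.
    by rewrite mulr_ge0// exprn_ge0// ltW.
  rewrite powRD; last by rewrite gt_eqF ?addr_gt0.
  rewrite powRr1// !exprS.
  have -> : C * (a K * a K `^ sg * (la ^+ n * 2^-1 ^+ n)) =
     (C * a K `^ sg) * (a K * la ^+ n * 2^-1 ^+ n) by ring.
  have -> : D * (2^-1 * 2^-1 ^+ n) * (a K * (la * la ^+ n)) =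
     (D * 2^-1 * la) * (a K * la ^+ n * 2^-1 ^+ n) by ring.
  rewrite ler_wpM2r ?mulr_ge0 ?exprn_ge0 ?(ltW la0) ?invr_ge0//.
  have -> : D * 2^-1 * la = C * a K `^ sg + 2^-1 * la.
    by rewrite /D; field; rewrite gt_eqF.
  by rewrite lerDl mulr_ge0 ?invr_ge0 ?(ltW la0).
exists (K + D); apply/eqP; rewrite eq_le a0 andbT.
apply/ler_addgt0Pl => e e0; rewrite addr0.
have : (a K * la ^+ n) @[n --> \oo] --> (0 : R).
  rewrite -[X in _ --> X](mulr0 (a K)); apply: cvgM; first exact: cvg_cst.
  by apply: cvg_expr; rewrite ger0_norm// ltW.
move=> /cvgr_lt/(_ _ e0)[n _ /(_ n (leqnn n)) an].
apply: le_trans (ltW an); apply: le_trans (ak n); apply: anon.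
by rewrite /k lerD2l ger_pMr// lerBlDr lerDl ltW.
Qed.

End sequences.

(** * Decay of superlevel sets *)

Lemma nneseries_geometric_le (R : realType) (c r : R) : 0 <= c -> 0 <= r -> r < 1 ->
  (\sum_(0 <= i <oo) (c * r ^+ i)%:E <= (c / (1 - r))%:E)%E.
Proof.
move=> c0 r0 r1.
apply: lime_le.
  by apply: is_cvg_nneseries => n _ _; rewrite lee_fin mulr_ge0// exprn_ge0.
apply: nearW => n; rewrite sumEFin lee_fin.
have := @geometric_seriesE R c r; rewrite lt_eqF// => /(_ isT)/(congr1 (fun f => f n)).
rewrite /series/= => ->; rewrite ler_pM2r ?invr_gt0 ?subr_gt0//.
by rewrite ler_piMr// lerBlDr lerDl exprn_ge0.
Qed.

Section layer_cake.
Context (R : realType) (n : nat) (Omega : set 'rV[R]_n) (u : 'rV[R]_n -> R).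
Hypotheses (mO : measurable Omega) (mu : measurable_fun setT u).
Local Notation leb := (@lebesgueN R n).
Local Notation SL := (superlevel Omega u).

(** On the dyadic shell of index j+i the integral is at most (2K 2^(j+i))^be times M 2^(-al (j+i));
    these bounds sum as a geometric series of ratio 2^(be-al) < 1. *)
Lemma layer_cake_decay (K M al be : R) (j : nat) : 0 < K -> 0 <= be -> be < al ->
  (forall j, leb (SL (K * 2 ^+ j)) <= (M * (2 `^ (- al)) ^+ j)%:E)%E ->
  (\int[leb]_(x in SL (K * 2 ^+ j)) (u x `^ be)%:E <=
    (M * (2 * K) `^ be / (1 - 2 `^ (be - al)) * (2 `^ (be - al)) ^+ j)%:E)%E.
Proof.
move=> K0 be0 bal aM.
have X0 l : 0 < K * 2 ^+ l by rewrite mulr_gt0// exprn_gt0.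
have Xle l m : (l <= m)%N -> K * 2 ^+ l <= K * 2 ^+ m.
  by move=> lm; rewrite ler_pM2l// ler_eXn2l// ltr1n.
pose F i := SL (K * 2 ^+ (j + i)) `&` [set x | u x <= K * 2 ^+ (j + i).+1].
have mF i : measurable (F i).
  apply: measurableI; first exact: measurable_superlevel.
  exact: measurable_set_ler.
have -> : SL (K * 2 ^+ j) = \bigcup_i F i.
  apply/seteqP; split => x; last first.
    by move=> [i _ [xi _]]; apply: superlevel_sub xi; apply: Xle; rewrite leq_addr.
  move=> [Ox /= jx].
  have ex : exists m, u x <= K * 2 ^+ m.
    exists (Num.truncn (u x / K)).+1.
    rewrite mulrC -ler_pdivrMr// ltW//.
    apply: lt_le_trans (Num.Theory.truncnS_gt _) _.
    by rewrite -natrX ler_nat ltnW// ltn_expl.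
  (* The least dyadic exponent whose level bounds [u x] is positive, since [u x] exceeds level [j];
     its predecessor labels the shell. *)
  case: (ex_minnP ex) => -[|m] um mmin.
    by move: jx; rewrite ltNge (le_trans um)// Xle.
  have jm : (j <= m)%N.
    rewrite leqNgt; apply/negP => mj.
    by move: jx; rewrite ltNge (le_trans um)// Xle.
  exists (m - j)%N => //; rewrite /F subnKC//; split => //; split => //=.
  by rewrite ltNge; apply/negP => /mmin; rewrite ltnn.
have tF : trivIset setT F.
  apply/trivIsetP => /= i l _ _; wlog il : i l / (i < l)%N.
    move=> H; rewrite neq_ltn => /orP[] il.
      by apply: H => //; rewrite neq_ltn il.
    by rewrite setIC; apply: H => //; rewrite neq_ltn il.
  move=> _; apply/seteqP; split => // x [[_ /= ui] [[_ /= ul] _]].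
  by move: ul; rewrite ltNge (le_trans ui)// Xle// -addnS leq_add2l.
rewrite ge0_integral_bigcup//; last 2 first.
  exact: measurable_powR_EFin.
  by move=> x _; rewrite lee_fin powR_ge0.
set r := 2 `^ (be - al).
have r0 : 0 <= r by rewrite powR_ge0.
have M0 : 0 <= M.
  by rewrite -[M]mulr1 -(expr0 (2 `^ (- al))) -lee_fin (le_trans _ (aM 0%N)).
have r1 : r < 1.
  by apply: gt1_powR_lt1; rewrite ?ltr1n// subr_lt0.
have c0 : 0 <= M * (2 * K) `^ be * r ^+ j.
  by rewrite !mulr_ge0 ?powR_ge0 ?exprn_ge0.
have -> : M * (2 * K) `^ be / (1 - r) * r ^+ j = M * (2 * K) `^ be * r ^+ j / (1 - r).
  by rewrite mulrAC.
apply: le_trans (nneseries_geometric_le c0 r0 r1).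
apply: lee_nneseries => [i _ _|i _].
  by apply: integral_ge0 => x _; rewrite lee_fin powR_ge0.
apply: (@le_trans _ _ (\int[leb]_(x in F i) (cst ((K * 2 ^+ (j + i).+1) `^ be)%:E x))%E).
  apply: ge0_le_integral => //.
  - by move=> x _; rewrite lee_fin powR_ge0.
  - exact: measurable_powR_EFin.
  - move=> x [[_ /= xi] /= ui]; rewrite lee_fin.
    apply: ge0_ler_powR; rewrite ?nnegrE ?(ltW (X0 _))//.
    exact: (le_trans (ltW (X0 _)) (ltW xi)).
rewrite integral_cst//.
apply: (@le_trans _ _ (((K * 2 ^+ (j + i).+1) `^ be)%:E * (M * (2 `^ (- al)) ^+ (j + i))%:E)%E).
  apply: lee_wpmul2l; first by rewrite lee_fin powR_ge0.
  apply: le_trans (aM _); apply: le_measure; rewrite ?inE//.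
    exact: measurable_superlevel.
  exact: subIsetl.
have rE : r = 2 `^ be * 2 `^ (- al).
  by rewrite /r powRD// pnatr_eq0 implybT.
rewrite -EFinM lee_fin -[_ * r ^+ j * _]mulrA -exprD rE exprMn.
have -> : K * 2 ^+ (j + i).+1 = 2 * K * 2 ^+ (j + i) by rewrite exprS; ring.
rewrite powRM ?exprn_ge0 ?mulr_ge0 ?(ltW K0)//.
rewrite powR_exprn//.
by rewrite le_eqVlt; apply/orP; left; apply/eqP; ring.
Qed.

End layer_cake.

(** Either [x <= la], or [x / la] is at least 1 and hence at most its [r]-th power. *)
Lemma young_split (R : realType) (x la r : R) : 0 <= x -> 0 < la -> 1 <= r ->
  x <= la + la `^ (1 - r) * x `^ r.
Proof.
move=> x0 la0 r1; have [xl|lx] := leP x la.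
  by rewrite (le_trans xl)// lerDl mulr_ge0 ?powR_ge0.
have : x / la <= (x / la) `^ r by rewrite le1r_powR// ler_pdivlMr// mul1r ltW.
rewrite ler_pdivrMr// => /le_trans; apply.
rewrite powRM ?invr_ge0 ?(ltW la0)// -powR_inv1 ?(ltW la0)// -powRrM mulN1r.
rewrite -mulrA -[X in _ * (_ * X)](powRr1 (ltW la0)) -powRD ?(gt_eqF la0) ?implybT//.
by rewrite [- r + 1]addrC mulrC lerDr (ltW la0).
Qed.

(** * Bootstrap of the decay exponent *)

Section superlevel_null.
Context (R : realType) (n : nat) (Omega : set 'rV[R]_n) (u : 'rV[R]_n -> R).
Hypotheses (mO : measurable Omega) (mu : measurable_fun setT u).
Local Notation leb := (@lebesgueN R n).
Local Notation SL := (superlevel Omega u).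
Hypothesis finO : (leb Omega < +oo)%E.
Let a k := fine (leb (SL k)).

Let mSL k : measurable (SL k). Proof. exact: measurable_superlevel. Qed.

Lemma superlevel_fin k : leb (SL k) = (fine (leb (SL k)))%:E.
Proof.
rewrite fineK// ge0_fin_numE//; apply: le_lt_trans finO.
by apply: le_measure; rewrite ?inE//; exact: subIsetl.
Qed.

Let aE k : leb (SL k) = (a k)%:E. Proof. exact: superlevel_fin. Qed.

Let a0 k : 0 <= a k. Proof. by rewrite /a fine_ge0. Qed.

Let anon k h : k <= h -> a h <= a k.
Proof.
move=> kh; rewrite -lee_fin -!aE; apply: le_measure; rewrite ?inE//.
exact: superlevel_sub.
Qed.

(** Hölder's inequality up to a constant, by integrating [young_split]. The choice la = a(k)^(-1/r)
    makes la a(k) and la^(1-r) both equal to a(k)^(1-1/r). *)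
Lemma integral_superlevel_hoelder (K k be r J : R) : 0 < K -> K <= k -> 1 <= r ->
  0 < a k ->
  (\int[leb]_(x in SL K) (u x `^ (be * r))%:E <= J%:E)%E ->
  (\int[leb]_(x in SL k) (u x `^ be)%:E <= ((1 + J) * a k `^ (1 - r^-1))%:E)%E.
Proof.
move=> K0 Kk r1 ak0 HJ.
have r0 : 0 < r by rewrite (lt_le_trans ltr01).
pose la := a k `^ (- r^-1).
have la0 : 0 < la by rewrite powR_gt0.
apply: (@le_trans _ _ (\int[leb]_(x in SL k)
    (la%:E + (la `^ (1 - r))%:E * (u x `^ (be * r))%:E))%E).
  apply: ge0_le_integral => //.
  - by move=> x _; rewrite lee_fin powR_ge0.
  - exact: measurable_powR_EFin.
  - apply: emeasurable_funD => //; apply: emeasurable_funM => //.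
    exact: measurable_powR_EFin.
  - move=> x _; rewrite -EFinM -EFinD lee_fin powRrM.
    by apply: young_split; rewrite ?powR_ge0.
rewrite ge0_integralD//; last 3 first.
  - by move=> x _; rewrite lee_fin ltW.
  - by move=> x _; rewrite -EFinM lee_fin mulr_ge0 ?powR_ge0.
  - apply: emeasurable_funM => //; exact: measurable_powR_EFin.
rewrite ge0_integralZl_EFin ?powR_ge0//; last 2 first.
  - by move=> x _; rewrite lee_fin powR_ge0.
  - exact: measurable_powR_EFin.
have -> : (\int[leb]_(x in SL k) la%:E = (la * a k)%:E)%E.
  rewrite (integral_cst _ (mSL k) la%:E) EFinM.
  by congr (_ * _)%E; exact: aE.
have JK : (\int[leb]_(x in SL k) (u x `^ (be * r))%:E <= J%:E)%E.
  apply: le_trans HJ; apply: ge0_subset_integral => //.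
  - exact: measurable_powR_EFin.
  - by move=> x _; rewrite lee_fin powR_ge0.
  - exact: superlevel_sub.
apply: (@le_trans _ _ ((la * a k)%:E + (la `^ (1 - r))%:E * J%:E)%E).
  by rewrite leeD2l// lee_wpmul2l// lee_fin powR_ge0.
rewrite -EFinM -EFinD lee_fin.
have -> : la * a k = a k `^ (1 - r^-1).
  rewrite -[X in _ * X](powRr1 (a0 k)) -powRD ?(gt_eqF ak0) ?implybT//.
  by rewrite addrC.
have -> : la `^ (1 - r) = a k `^ (1 - r^-1).
  rewrite /la -powRrM; congr (_ `^ _); field.
  by rewrite gt_eqF.
by rewrite mulrDl mul1r mulrC.
Qed.

Variables (K p th C1 C2 : R).
Hypotheses (K1 : 1 <= K) (th0 : 0 < th) (th1 : th < 1) (p2 : 2 < p).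
Hypotheses (pq : p < 2 / (1 - th)) (C10 : 0 <= C1) (C20 : 0 <= C2).
(** [H1] abstracts the energy estimate for [u] itself, whose finite energy is absorbed into [C1];
    [H2] abstracts the one for truncations, whose energy the equation controls. [B] is left free
    because the bound on the integral improves at each round. *)
Hypothesis H1 : forall k h, K <= k -> k < h ->
  (((h - k) ^+ 2)%:E * leb (SL h) <= (C1 * (fine (leb (SL k))) `^ th)%:E)%E.
Hypothesis H2 : forall k h B, K <= k -> k < h ->
  (\int[leb]_(x in SL k) (u x `^ (p - 1))%:E <= B%:E)%E ->
  ((h - k)%:E * leb (SL h) <= (C2 * (fine (leb (SL k))) `^ th * B)%:E)%E.

Let K0 : 0 < K. Proof. exact: lt_le_trans K1. Qed.
(** For th = 2s/N this is the critical exponent 2N/(N-2s). *)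
Let q := 2 / (1 - th).
Let th1' : 0 < 1 - th. Proof. by rewrite subr_gt0. Qed.

Let lev (j : nat) := K * 2 ^+ j.
Let levK j : K <= lev j.
Proof. by rewrite /lev ler_peMr ?(ltW K0)// exprn_ege1// ler1n. Qed.
Let levS j : lev j.+1 - lev j = lev j.
Proof. by rewrite /lev exprS; ring. Qed.
Let lev2 j : 2 ^+ j <= lev j.
Proof. by rewrite /lev ler_peMl// exprn_ge0. Qed.
Let lev0 j : 0 < lev j. Proof. exact: lt_le_trans (levK j). Qed.
Let levSlt j : lev j < lev j.+1.
Proof. by rewrite -subr_gt0 levS. Qed.

(** The decay a(k) = O(k^(-al)), sampled at dyadic levels. *)
Let decays al := exists2 M, 0 <= M & forall j, a (lev j) <= M * (2 `^ (- al)) ^+ j.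

(** Consecutive levels differ by [lev j >= 2 ^+ j], so [H1] becomes a sublinear recursion with
    factor 4^(-j). *)
Let decay_base : decays q.
Proof.
apply: (@sublinear_recursion_decay _ _ C1) => // j.
have := H1 (levK j) (levSlt j); rewrite levS aE -EFinM lee_fin -/(a _) => H.
have e0 : 0 < (2 ^+ j) ^+ 2 :> R by rewrite !exprn_gt0.
have -> : (2 `^ (- 2)) ^+ j = ((2 ^+ j) ^+ 2)^-1 :> R.
  by rewrite powR_invn// exprVn exprAC.
rewrite mulrAC ler_pdivlMr// mulrC; apply: le_trans H.
by rewrite ler_wpM2r// lerXn2r ?nnegrE ?exprn_ge0 ?(ltW (lev0 _)).
Qed.

(** Decay of order al makes the integral in [H2] of order 2^((p-1-al)j). Dividing by the level gap
    yields the exponent al th + al - p + 2, and al th >= q th = q - 2. *)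
Let decay_step al : q <= al -> decays al -> decays (al + (q - p)).
Proof.
move=> qal [M M0 aM].
have pal : p - 1 < al.
  by have : p < q by []; move: qal; lra.
have p10 : 0 <= p - 1 by move: p2; lra.
set b := 2 `^ (- al) in aM.
set r : R := 2 `^ (p - 1 - al).
have r1 : r < 1.
  by apply: gt1_powR_lt1; rewrite ?ltr1n// subr_lt0.
have [c c0 I] : exists2 c, 0 <= c & forall j,
    (\int[leb]_(x in SL (lev j)) (u x `^ (p - 1))%:E <= (c * r ^+ j)%:E)%E.
  exists (M * (2 * K) `^ (p - 1) / (1 - r)).
    by rewrite divr_ge0 ?subr_ge0 ?(ltW r1)// mulr_ge0// powR_ge0.
  by move=> j; apply: layer_cake_decay => // l; rewrite aE lee_fin; exact: aM.
apply: (@geometric_decay_shift _ _ (C2 * M `^ th * c)).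
- by rewrite powR_gt0.
- by apply: mulr_ge0 => //; apply: mulr_ge0 => //; exact: powR_ge0.
move=> j.
have := H2 (levK j) (levSlt j) (I j); rewrite levS aE -EFinM lee_fin -/(a _) => H.
have e0 : 0 < 2 ^+ j :> R by rewrite exprn_gt0.
rewrite -(ler_pM2l e0).
apply: (@le_trans _ _ (lev j * a (lev j.+1))); first by rewrite ler_wpM2r.
apply: (le_trans H).
apply: (@le_trans _ _ (C2 * (M `^ th * (b `^ th) ^+ j) * (c * r ^+ j))).
  rewrite ler_wpM2r ?mulr_ge0 ?exprn_ge0 ?powR_ge0// ler_wpM2l//.
  rewrite -powR_exprn ?powR_ge0// -powRM ?exprn_ge0 ?powR_ge0//.
  apply: ge0_ler_powR; rewrite ?nnegrE ?(ltW th0)//.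
  by rewrite mulr_ge0 ?exprn_ge0 ?powR_ge0.
have -> : C2 * (M `^ th * (b `^ th) ^+ j) * (c * r ^+ j) =
    C2 * M `^ th * c * (b `^ th * r) ^+ j by rewrite exprMn; ring.
rewrite [leRHS]mulrCA ler_wpM2l ?mulr_ge0 ?powR_ge0// -exprMn.
apply: lerXn2r; rewrite ?nnegrE ?mulr_ge0 ?powR_ge0//.
rewrite /b /r -powRrM -[X in _ <= X * _](@powRr1 _ 2)//.
rewrite -!powRD ?pnatr_eq0 ?implybT//.
apply: ler_powR; first by rewrite ler1n.
have qth : q * th = q - 2 by rewrite /q; field; rewrite gt_eqF.
have : q * th <= al * th by rewrite ler_wpM2r// ltW.
rewrite qth; lra.
Qed.

(** Each step gains the fixed amount [q - p > 0], so finitely many steps make u^be integrable over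
    [SL K]; [H2] then becomes a superlinear recursion, to which [stampacchia] applies. *)
Lemma superlevel_null : exists T, leb (SL T) = 0%E.
Proof.
have decm m : decays (q + m%:R * (q - p)).
  elim: m => [|m IH]; first by rewrite mul0r addr0.
  rewrite -natr1 mulrDl mul1r addrA; apply: decay_step => //.
  by rewrite lerDl mulr_ge0// subr_ge0 ltW.
(* With this [r] the exponent th + (1 - 1/r) produced by [H2] and Hölder's inequality equals 1 +
   th/2. *)
pose r := 2 / th.
have r1 : 1 <= r by rewrite ler_pdivlMr// mul1r ltW// (lt_trans th1)// ltr1n.
pose be := (p - 1) * r.
have p1 : 0 < p - 1 by move: p2; lra.
have be0 : 0 < be by rewrite mulr_gt0// (lt_le_trans ltr01).
have qp : 0 < q - p by rewrite subr_gt0.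
pose m := (Num.truncn (be / (q - p))).+1.
pose al := q + m%:R * (q - p).
have beal : be < al.
  apply: (@lt_trans _ _ (m%:R * (q - p))).
    by rewrite -ltr_pdivrMr//; exact: Num.Theory.truncnS_gt.
  by rewrite ltrDr divr_gt0.
have [M M0 aM] := decm m.
have := @layer_cake_decay _ _ _ _ mO mu K M al be 0 K0 (ltW be0) beal.
set J := (X in (_ -> _ <= X%:E)%E); rewrite expr0 mulr1 => /(_ _)HJ.
have {}HJ : (\int[leb]_(x in SL K) (u x `^ be)%:E <= J%:E)%E.
  by apply: HJ => j; rewrite aE lee_fin; exact: aM.
have J0 : 0 <= J.
  rewrite -lee_fin; apply: le_trans HJ; apply: integral_ge0 => x _.
  by rewrite lee_fin powR_ge0.
have th20 : 0 < th / 2 by rewrite divr_gt0.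
have [T aT] : exists T, a T = 0.
  apply: (@stampacchia _ a K (C2 * (1 + J)) (th / 2)) => //.
    by rewrite mulr_ge0// addr_ge0.
  move=> k h Kk kh.
  (* The Hölder estimate needs positive measure; otherwise [a h = 0] by monotonicity. *)
  have [ak0|ak0] := leP (a k) 0.
    have -> : a h = 0.
      by apply/eqP; rewrite eq_le a0 (le_trans _ ak0)// anon// ltW.
    by rewrite mulr0 mulr_ge0 ?powR_ge0// mulr_ge0// addr_ge0.
  have := H2 Kk kh (integral_superlevel_hoelder K0 Kk r1 ak0 HJ).
  rewrite aE -EFinM lee_fin -/(a _) => /le_trans; apply.
  rewrite le_eqVlt; apply/orP; left; apply/eqP.
  have -> : 1 + th / 2 = th + (1 - r^-1) by rewrite /r; field; rewrite gt_eqF.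
  by rewrite powRD ?(gt_eqF ak0) ?implybT//; ring.
by exists T; rewrite aE aT.
Qed.

End superlevel_null.

(** * Weak solutions *)

Section test_functions.
Context (R : realType) (n : nat).
Local Notation leb := (@lebesgueN R n).
Implicit Types (s eps : R) (Omega : set 'rV[R]_n) (u v : 'rV[R]_n -> R).

Lemma CNs_ge0 s : 0 <= CNs n s.
Proof.
rewrite /CNs invr_ge0 fine_ge0// integral_ge0// => z _.
by rewrite lee_fin divr_ge0 ?powR_ge0// subr_ge0 cos_le1.
Qed.

Lemma Hs_coef_ge0 s eps : 0 <= CNs n s * eps `^ (2 * s) / 2.
Proof. by rewrite divr_ge0// mulr_ge0 ?powR_ge0// CNs_ge0. Qed.

(** The increments of [u] and [phi \o u] have the same sign. *)
Lemma gagliardo_homo_ge0 s u (phi : R -> R) z :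
  {homo phi : x y / x <= y} -> 0 <= gagliardo s u (phi \o u) z.
Proof.
move=> phi_homo; rewrite /gagliardo divr_ge0 ?powR_ge0//=.
have [uz|/ltW uz] := leP (u z.1) (u z.2).
  by rewrite mulr_le0 ?subr_le0// phi_homo.
by rewrite mulr_ge0 ?subr_ge0// phi_homo.
Qed.

Lemma gagliardo_ge0 s u z : 0 <= gagliardo s u u z.
Proof. exact: (@gagliardo_homo_ge0 _ _ id). Qed.

Lemma measurable_setXC Omega : measurable Omega ->
  measurable (~` (~` Omega `*` ~` Omega)).
Proof.
by move=> mO; apply: measurableC; apply: measurableX; exact: measurableC.
Qed.

Lemma measurable_gagliardo_EFin s u v D : measurable_fun setT u ->
  measurable_fun setT v -> measurable_fun D (fun z => (gagliardo s u v z)%:E).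
Proof.
by move=> mu mv; apply/measurable_EFinP/measurable_funTS; exact: measurable_gagliardo.
Qed.

Lemma measurable_mul_EFin u v D : measurable_fun setT u ->
  measurable_fun setT v -> measurable_fun D (fun x => (u x * v x)%:E).
Proof.
by move=> mu mv; apply/measurable_EFinP/measurable_funTS; exact: measurable_funM.
Qed.

(** Normal contractions increase neither the Gagliardo energy nor the L^2 norm. *)
Lemma Hs_comp eps s Omega u (phi : R -> R) : measurable Omega ->
  measurable_fun setT phi -> (forall x y, `|phi x - phi y| <= `|x - y|) ->
  (forall x, `|phi x| <= `|x|) -> Hs eps s Omega u -> Hs eps s Omega (phi \o u).
Proof.
move=> mO mphi lip phi0 [mu uoo].
have mpu : measurable_fun setT (phi \o u) by exact: measurableT_comp.
split => //; apply: le_lt_trans uoo; rewrite /Hs_prod.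
have sq (x y : R) : `|x| <= `|y| -> x * x <= y * y.
  move=> xy; rewrite -!expr2 -(real_normK (num_real x)).
  by rewrite -(real_normK (num_real y)) lerXn2r ?nnegrE.
apply: leeD.
  apply: lee_wpmul2l; first by rewrite lee_fin Hs_coef_ge0.
  apply: ge0_le_integral.
  - exact: measurable_setXC.
  - by move=> z _; rewrite lee_fin gagliardo_ge0.
  - exact: measurable_gagliardo_EFin.
  - exact: measurable_gagliardo_EFin.
  - move=> z _; rewrite lee_fin ler_wpM2r ?invr_ge0 ?powR_ge0//; exact/sq/lip.
apply: ge0_le_integral => //.
- by move=> x _; rewrite lee_fin -expr2 sqr_ge0.
- exact: measurable_mul_EFin.
- exact: measurable_mul_EFin.
- move=> x _; rewrite lee_fin; exact/sq/phi0.
Qed.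

Lemma Hs_sqr_integral eps s Omega u : measurable Omega -> Hs eps s Omega u ->
  (\int[leb]_(x in Omega) (u x * u x)%:E < +oo)%E.
Proof.
move=> mO [mu]; apply: le_lt_trans; rewrite /Hs_prod leeDr// mule_ge0//.
  by rewrite lee_fin Hs_coef_ge0.
by apply: integral_ge0 => z _; rewrite lee_fin gagliardo_ge0.
Qed.

(** Positivity of the coefficient matters: in [\bar R] the product of 0 and [+oo] is 0, which would
    hide an infinite energy. *)
Lemma Hs_gagliardo_integral eps s Omega u : measurable Omega ->
  0 < CNs n s * eps `^ (2 * s) / 2 -> Hs eps s Omega u ->
  (\int[leb \x leb]_(z in ~` (~` Omega `*` ~` Omega)) (gagliardo s u u z)%:E < +oo)%E.
Proof.
move=> mO c0 [mu uoo]; rewrite ltey; apply/negP => /eqP E; move: uoo.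
rewrite /Hs_prod E gt0_muley ?lte_fin// addye ?ltxx// gt_eqF//.
apply: (@lt_le_trans _ _ 0%E); first exact: ltNy0.
by apply: integral_ge0 => x _; rewrite lee_fin -expr2 sqr_ge0.
Qed.

(** * Truncations *)

Definition trunc (k h t : R) := Num.min (Num.max (t - k) 0) (h - k).

(** Splitting into the three regimes reduces later estimates on [trunc] to arithmetic on an explicit
    value. *)
Lemma truncP (k h t : R) : k < h ->
  [\/ t <= k /\ trunc k h t = 0, [/\ k < t, t <= h & trunc k h t = t - k] |
      h < t /\ trunc k h t = h - k].
Proof.
move=> kh; rewrite /trunc; have [tk|kt] := leP t k.
  apply: Or31; split => //; rewrite max_r ?subr_le0// min_l//.
  by rewrite subr_ge0 ltW.
rewrite max_l ?subr_ge0 ?(ltW kt)//.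
have [th|ht] := leP t h.
  by apply: Or32; split => //; rewrite min_l// lerD2r.
by apply: Or33; split => //; rewrite min_r// lerD2r ltW.
Qed.

Lemma trunc_homo (k h : R) : k < h -> {homo trunc k h : x y / x <= y}.
Proof.
move=> kh x y xy.
case: (truncP x kh) => [[? ->]|[? ? ->]|[? ->]];
case: (truncP y kh) => [[? ->]|[? ? ->]|[? ->]]; lra.
Qed.

Lemma trunc_lip (k h x y : R) : k < h -> `|trunc k h x - trunc k h y| <= `|x - y|.
Proof.
move=> kh.
wlog xy : x y / x <= y.
  move=> H; have [/H//|/ltW/H] := leP x y.
  by rewrite distrC [leRHS]distrC.
have txy := trunc_homo kh xy.
rewrite !ler0_norm ?subr_le0// !opprB.
case: (truncP x kh) => [[? ->]|[? ? ->]|[? ->]];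
case: (truncP y kh) => [[? ->]|[? ? ->]|[? ->]]; lra.
Qed.

Lemma measurable_trunc (k h : R) : measurable_fun setT (trunc k h).
Proof.
apply: measurable_minr => //; apply: measurable_maxr => //.
exact: measurable_funB.
Qed.

End test_functions.

(** * Testing the weak equation *)

Section weak_solutions.
Context (R : realType) (n : nat) (eps s : R) (Omega : set 'rV[R]_n) (f : R -> R)
  (u : 'rV[R]_n -> R).
Local Notation leb := (@lebesgueN R n).
Local Notation SL := (superlevel Omega).
Local Notation D := (~` (~` Omega `*` ~` Omega)).
Local Notation c := (CNs n s * eps `^ (2 * s) / 2).
Hypothesis mO : measurable Omega.
Hypothesis wu : weak_solution eps s Omega f u.
Hypothesis f_neg : forall t, t < 0 -> f t = 0.
Hypothesis f_cont : continuous f.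

Let mu : measurable_fun setT u. Proof. by have [[]] := wu. Qed.

Let mf : measurable_fun setT (f \o u).
Proof. by apply: measurableT_comp => //; exact: continuous_measurable_fun. Qed.

Let G_ge0 (phi : R -> R) : {homo phi : x y / x <= y} ->
  (0 <= \int[leb \x leb]_(z in D) (gagliardo s u (phi \o u) z)%:E)%E.
Proof.
by move=> phi_homo; apply: integral_ge0 => z _; rewrite lee_fin gagliardo_homo_ge0.
Qed.

Lemma Linfty_of_null (T S : R) : leb (SL u T) = 0%E -> leb (SL (\- u) S) = 0%E ->
  Linfty Omega u.
Proof.
move=> uT uS; split; first exact: measurable_funTS.
rewrite unlock; case: ifPn => // _.
(* The maximum with 0 covers the points outside [Omega], where the restricted function is 0. *)
apply: (@le_lt_trans _ _ (Num.max (Num.max T S) 0)%:E); last exact: ltry.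
apply/ess_supP; apply: (@negligibleS _ _ _ _ (SL u T `|` SL (\- u) S)); last first.
  apply: negligibleU; apply/negligibleP => //; apply: measurable_superlevel => //.
  exact: measurable_funN.
move=> x /= /negP; rewrite -ltNge patchE; case: ifPn => [xO|_]; last first.
  by rewrite abse0 lte_fin gt_max ltxx andbF.
rewrite /= lte_fin !gt_max => /andP[/andP[Tu Su] _]; rewrite inE in xO.
have [u0|u0] := leP 0 (u x).
  by left; split => //=; rewrite -(ger0_norm u0).
by right; split => //=; rewrite -(ltr0_norm u0).
Qed.

(** The product f(u) min(u,0) vanishes identically, so both nonnegative terms of the form vanish.
    Since u min(u,0) >= 1 where u < -1, Markov's inequality concludes. *)
Lemma weak_solution_negative_part_null : leb (SL (\- u) 1) = 0%E.
Proof.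
have [uH uw] := wu.
pose phi (t : R) := Num.min t 0.
have phi_homo : {homo phi : x y / x <= y}.
  by move=> x y xy; rewrite /phi; case: (leP x 0) => ?; case: (leP y 0) => ?; lra.
have phiH : Hs eps s Omega (phi \o u).
  apply: Hs_comp => //.
  - by apply: measurable_minr.
  - move=> x y; wlog xy : x y / x <= y.
      move=> H; have [/H//|/ltW/H] := leP x y.
      by rewrite distrC [leRHS]distrC.
    have := phi_homo _ _ xy => pxy.
    rewrite !ler0_norm ?subr_le0// !opprB /phi.
    by case: (leP x 0) => ?; case: (leP y 0) => ?; lra.
  - move=> x; rewrite /phi; case: (leP x 0) => // ?.
    by rewrite normr0.
have := uw _ phiH.
rewrite [X in _ = X -> _](_ : _ = 0%E); last first.
  apply: integral0_eq => x _; rewrite /phi/=; congr (_%:E).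
  by have [ux|ux] := ltP (u x) 0; rewrite ?mulr0// f_neg// mul0r.
rewrite /Hs_prod => E.
have E2 : (\int[leb]_(x in Omega) (u x * (phi \o u) x)%:E <= 0)%E.
  rewrite -E leeDr// mule_ge0//; first by rewrite lee_fin Hs_coef_ge0.
  exact: G_ge0.
apply/eqP; rewrite eq_le measure_ge0 andbT; apply: le_trans E2.
rewrite -[leLHS]mul1e; apply: ge0_cst_le_integral => //.
- by apply: measurable_superlevel => //; exact: measurable_funN.
- exact: subIsetl.
- by apply: measurable_mul_EFin => //; have [] := phiH.
- move=> x _; rewrite lee_fin /= /phi.
  by case: (leP (u x) 0) => ?; rewrite ?mulr0// -expr2 sqr_ge0.
- move=> x [_ /= ux]; rewrite lee_fin /phi min_l; last by lra.
  nra.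
Qed.

(** With v the truncation, dropping the nonnegative term in u v bounds the energy by the integral of
    f(u) v, where v <= h - k and v vanishes off [SL u k]. *)
Lemma weak_solution_trunc_energy (k h B p : R) : 0 <= k -> k < h ->
  (forall t, k < t -> 0 <= f t <= t `^ (p - 1)) ->
  (\int[leb]_(x in SL u k) (u x `^ (p - 1))%:E <= B%:E)%E ->
  (c%:E * \int[leb \x leb]_(z in D) (gagliardo s u (trunc k h \o u) z)%:E <=
   ((h - k) * B)%:E)%E.
Proof.
move=> k0 kh fp HB; have [uH uw] := wu.
have vH : Hs eps s Omega (trunc k h \o u).
  apply: Hs_comp => //.
  - exact: measurable_trunc.
  - by move=> x y; exact: trunc_lip.
  - move=> x; have := trunc_lip x 0 kh.
    case: (truncP 0 kh) => [[_ ->]|[? _ _]|[? _]].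
    + by rewrite !subr0.
    + by move: k0; lra.
    + by move: k0; lra.
have mv : measurable_fun setT (trunc k h \o u) by have [] := vH.
have := uw _ vH; rewrite /Hs_prod => E.
apply: (@le_trans _ _ (\int[leb]_(x in Omega) (f (u x) * (trunc k h \o u) x)%:E)%E).
  (* The product is nonnegative because the truncation vanishes unless u > k >= 0. *)
  rewrite -E leeDl//; apply: integral_ge0 => x _; rewrite lee_fin /=.
  case: (truncP (u x) kh) => [[_ ->]|[? _ ->]|[? ->]].
  - by rewrite mulr0.
  - by rewrite mulr_ge0; lra.
  - by rewrite mulr_ge0; lra.
apply: (@le_trans _ _ ((h - k)%:E * \int[leb]_(x in SL u k) (u x `^ (p - 1))%:E)%E); last first.
  by rewrite EFinM lee_wpmul2l// lee_fin subr_ge0 ltW.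
have mS : measurable (SL u k) by exact: measurable_superlevel.
rewrite -ge0_integralZl_EFin//; last 3 first.
- by move=> x _; rewrite lee_fin powR_ge0.
- exact: measurable_powR_EFin.
- by rewrite subr_ge0 ltW.
rewrite /superlevel integral_mkcondr.
apply: ge0_le_integral => //.
- move=> x _; rewrite lee_fin /=.
  case: (truncP (u x) kh) => [[_ ->]|[ku _ ->]|[hu ->]].
  + by rewrite mulr0.
  + by rewrite mulr_ge0 ?subr_ge0 ?(ltW ku)//; case/andP: (fp _ ku).
  + rewrite mulr_ge0 ?subr_ge0 ?(ltW kh)//.
    by case/andP: (fp _ (lt_trans kh hu)).
- by apply: measurable_mul_EFin.
- apply/measurable_restrict => //; first exact: measurable_set_ltr.
  by apply: emeasurable_funM => //; exact: measurable_powR_EFin.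
- move=> x _; rewrite patchE; case: ifPn; rewrite ?inE/= => ku.
    rewrite -EFinM lee_fin mulrC; case/andP: (fp _ ku) => f0 fu.
    apply: ler_pM => //; case: (truncP (u x) kh) => [[? ->]|[? ? ->]|[? ->]]; lra.
  rewrite lee_fin; case: (truncP (u x) kh) => [[_ ->]|[? _ ->]|[? ->]].
  + by rewrite mulr0.
  + by move/negP: ku => []; rewrite inE.
  + by move/negP: ku => []; rewrite inE; exact: lt_trans kh _.
Qed.

(** The form reduces to the L^2 product, so the indicator of {u > T} is an admissible test function.
    The integral of u over [SL u T] then equals that of f(u), which is at least twice as large;
    being finite, it is 0. *)
Lemma weak_solution_degenerate (T : R) : c = 0 -> (leb Omega < +oo)%E ->
  1 <= T -> (forall t, T < t -> 2 * t <= f t) -> leb (SL u T) = 0%E.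
Proof.
move=> c0 finO T1 fT; have [uH uw] := wu.
have mS : measurable (SL u T) by exact: measurable_superlevel.
have mT : measurable [set x | T < u x] by exact: measurable_set_ltr.
pose v : 'rV[R]_n -> R := \1_[set x | T < u x].
have vH : Hs eps s Omega v.
  split; first exact: measurable_indic.
  rewrite /Hs_prod c0 mul0e add0e; apply: le_lt_trans finO.
  rewrite -[leRHS]mul1e -(integral_cst _ mO 1%E); apply: ge0_le_integral => //.
  - by move=> x _; rewrite lee_fin -expr2 sqr_ge0.
  - by apply: measurable_mul_EFin => //; exact: measurable_indic.
  - by move=> x _; rewrite lee_fin /v indicE; case: (_ \in _); rewrite ?mulr0 ?mulr1.
have restr (g : R -> R) : (\int[leb]_(x in Omega) (g (u x) * v x)%:E =
    \int[leb]_(x in SL u T) (g (u x))%:E)%E.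
  rewrite /superlevel integral_mkcondr; apply: eq_integral => x _.
  by rewrite patchE /v indicE; case: ifPn => _; rewrite ?mulr1 ?mulr0.
have := uw _ vH; rewrite /Hs_prod c0 mul0e add0e (restr id) (restr f) => E.
have I0 : (0 <= \int[leb]_(x in SL u T) (u x)%:E)%E.
  by apply: integral_ge0 => x [_ /= ux]; rewrite lee_fin; lra.
have mue : measurable_fun setT (EFin \o u) by exact/measurable_EFinP.
have I2 : (2%:E * \int[leb]_(x in SL u T) (u x)%:E <= \int[leb]_(x in SL u T) (u x)%:E)%E.
  rewrite [leRHS]E -ge0_integralZl_EFin//; last 2 first.
  - by move=> x [_ /= ux]; rewrite lee_fin; lra.
  - exact: measurable_funTS.
  apply: ge0_le_integral => //.
  - by move=> x [_ /= ux]; rewrite -EFinM lee_fin; lra.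
  - by apply: emeasurable_funM => //; exact: measurable_funTS.
  - by apply: measurable_funTS; exact/measurable_EFinP.
  - by move=> x [_ /= ux]; rewrite -EFinM lee_fin fT.
(* Finiteness rules out [+oo] in [I2]; it follows from u <= u^2, valid since u > T >= 1. *)
have Ioo : (\int[leb]_(x in SL u T) (u x)%:E < +oo)%E.
  apply: le_lt_trans (Hs_sqr_integral mO uH).
  apply: (@le_trans _ _ (\int[leb]_(x in SL u T) (u x * u x)%:E)%E).
    apply: ge0_le_integral => //.
    - by move=> x [_ /= ux]; rewrite lee_fin; lra.
    - exact: measurable_funTS.
    - exact: measurable_mul_EFin.
    - by move=> x [_ /= ux]; rewrite lee_fin; nra.
  apply: ge0_subset_integral => //.
  - exact: measurable_mul_EFin.
  - by move=> x _; rewrite lee_fin -expr2 sqr_ge0.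
  - exact: subIsetl.
have I00 : (\int[leb]_(x in SL u T) (u x)%:E <= 0)%E.
  move: I0 I2 Ioo; case: (integral _ _ _) => [r| |]//.
  by rewrite -EFinM !lee_fin => ? ? _; lra.
apply/eqP; rewrite eq_le measure_ge0 andbT; apply: le_trans I00.
rewrite -[leLHS]mul1e; apply: ge0_cst_le_integral => //.
- exact: measurable_funTS.
- by move=> x [_ /= ux]; rewrite lee_fin; lra.
- by move=> x [_ /= ux]; rewrite lee_fin; lra.
Qed.

End weak_solutions.

(** Markov's inequality for u^2, which is at least [K] where u > K >= 1. *)
Lemma superlevel_small (R : realType) (n : nat) (Omega : set 'rV[R]_n)
    (u : 'rV[R]_n -> R) (m : R) : measurable Omega -> measurable_fun setT u ->
  (\int[@lebesgueN R n]_(x in Omega) (u x * u x)%:E < +oo)%E -> 0 < m ->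
  exists2 K0 : R, 1 <= K0 & forall K, K0 <= K ->
    (lebesgueN (superlevel Omega u K) <= m%:E)%E.
Proof.
move=> mO mu; set I := integral _ _ _ => Ioo m0.
have I0 : (0 <= I)%E.
  by apply: integral_ge0 => x _; rewrite lee_fin -expr2 sqr_ge0.
have IE : I = (fine I)%:E by rewrite fineK// ge0_fin_numE.
exists (1 + fine I / m); first by rewrite lerDl divr_ge0 ?fine_ge0// ltW.
move=> K KK.
have I0' : 0 <= fine I / m by rewrite divr_ge0 ?fine_ge0// ltW.
have K1 : 1 <= K by apply: le_trans KK; rewrite lerDl.
have K0 : 0 < K by rewrite (lt_le_trans ltr01).
have : (K%:E * lebesgueN (superlevel Omega u K) <= I)%E.
  apply: ge0_cst_le_integral => //.
  - exact: measurable_superlevel.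
  - exact: subIsetl.
  - exact: measurable_mul_EFin.
  - by move=> x _; rewrite lee_fin -expr2 sqr_ge0.
  - exact: ltW.
  - by move=> x [_ /= Ku]; rewrite lee_fin; nra.
rewrite -lee_pdivlMl// => /le_trans; apply.
rewrite IE -EFinM lee_fin mulrC ler_pdivrMr// -ler_pdivrMl//.
by rewrite mulrC; lra.
Qed.

Theorem theorem2 (R : realType) (N : nat) (s : R) (Omega : set 'rV[R]_N)
    (f : R -> R)
    (s01 : 0 < s < 1) (N2s : 2 * s < N%:R)
    (OmegaD : smooth_bounded_domain Omega)
    (f_cont : continuous f)
    (f1 : (forall t, t < 0 -> f t = 0) /\ (forall t, 0 < t -> 0 < f t))
    (f2 : f t / t @[t --> 0^'+] --> 0 /\
      exists p : R, 2 < p < 2 * N%:R / (N%:R - 2 * s) /\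
        f t / t `^ (p - 1) @[t --> +oo] --> 0)
    (f3 : f t / t @[t --> +oo] --> +oo) :
  exists eps0 : R, 0 < eps0 /\
    forall eps : R, 0 < eps < eps0 ->
    forall u : 'rV[R]_N -> R,
      weak_solution eps s Omega f u -> Linfty Omega u.
Proof.
have [s0 s1] := andP s01.
have [_ oO _ bO _] := OmegaD.
have mO : measurable Omega by exact: open_measurable_rV.
have finO := bounded_set_fin_measure mO bO.
have [f_neg f_pos] := f1.
have N0 : 0 < N%:R :> R by rewrite (lt_trans _ N2s)// mulr_gt0.
exists 1; split => // eps _ u wu.
have [[mu _] _] := wu.
have uH : Hs eps s Omega u by case: wu.
have lower := weak_solution_negative_part_null mO wu f_neg.
suff [T uT] : exists T, lebesgueN (superlevel Omega u T) = 0%E.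
  exact: (Linfty_of_null mO wu uT lower).
have := Hs_coef_ge0 N s eps; rewrite le_eqVlt => /predU1P[/esym c0|c0].
  move/cvgryPge : f3 => /(_ 2) [M [_ MP]].
  exists (Num.max M 1); apply: (weak_solution_degenerate mO wu f_cont c0 finO).
    by rewrite le_max lexx orbT.
  move=> t; rewrite gt_max => /andP[Mt t1].
  by rewrite -ler_pdivlMr ?(lt_trans ltr01)//; exact: MP.
have [_ [p [/andP[p2 pq] fp]]] := f2.
have [T [_ fT]] : \forall t \near +oo, f t / t `^ (p - 1) <= 1.
  by move/cvgr_le: fp; apply.
have [t0 t00 cO] := smooth_bounded_domain_corkscrew OmegaD.
have N0n : (0 < N)%N by rewrite -(ltr0n R).
have [C C0 [m m0 energy]] := level_set_energy N0n s0 t00 mO cO.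
have [K0 K01 Km] := superlevel_small mO mu (Hs_sqr_integral mO uH) m0.
(* Above [K0] the superlevel sets are small enough for [energy]; above [T] the growth bound f(t) <=
   t^(p-1) holds. *)
pose K := Num.max K0 T.
have K1 : 1 <= K by rewrite /K le_max K01.
have fK k t : K <= k -> k < t -> 0 <= f t <= t `^ (p - 1).
  move=> Kk kt; have t_gt0 : 0 < t.
    by rewrite (lt_trans _ kt)// (lt_le_trans _ Kk)// (lt_le_trans ltr01).
  rewrite ltW ?f_pos//= -[leRHS]mul1r -ler_pdivrMr ?powR_gt0//.
  by apply: fT; rewrite (le_lt_trans _ kt)// (le_trans _ Kk)// /K le_max lexx orbT.
have am k : K <= k -> fine (lebesgueN (superlevel Omega u k)) <= m.
  move=> Kk; rewrite -lee_fin -superlevel_fin//; apply: Km.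
  by rewrite (le_trans _ Kk)// /K le_max lexx.
set c := (X in 0 < X) in c0.
set D := ~` (~` Omega `*` ~` Omega) in energy.
pose E := (\int[@lebesgueN R N \x @lebesgueN R N]_(z in D) (gagliardo s u u z)%:E)%E.
have E0 : (0 <= E)%E.
  by apply: integral_ge0 => z _; rewrite lee_fin gagliardo_ge0.
have EE : E = (fine E)%:E.
  by rewrite fineK// ge0_fin_numE//; exact: (Hs_gagliardo_integral mO c0 uH).
have th1 : 2 * s / N%:R < 1 by rewrite ltr_pdivrMr// mul1r.
apply: (@superlevel_null _ _ _ _ mO mu finO K p (2 * s / N%:R) (C * fine E) (C / c)) => //.
- by rewrite divr_gt0// mulr_gt0.
- apply: (lt_le_trans pq); rewrite le_eqVlt; apply/orP; left; apply/eqP.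
  by field; rewrite !gt_eqF ?subr_gt0.
- by rewrite mulr_ge0 ?fine_ge0// ltW.
- by rewrite divr_ge0// ltW.
(* For the pairs considered by [energy] the increment of [u] is at least [h - k], and it occurs
   squared. *)
- move=> k h Kk kh.
  have := energy u (gagliardo s u u) k h _ mu (measurable_gagliardo _ mu mu)
    (fun z => gagliardo_ge0 s u z) _ kh (superlevel_fin mO mu finO k) (am k Kk).
  rewrite -/E EE -EFinM mulrAC; apply.
  move=> x y hx ky; rewrite /gagliardo/= ler_wpM2r ?invr_ge0 ?powR_ge0//.
  by rewrite -expr2 lerXn2r ?nnegrE; lra.
(* Here the increment of the truncation is exactly [h - k] and that of [u] at least [h - k]. Since
   [te] bounds the energy times [c] by [(h - k) * B], one factor [h - k] cancels. *)
- move=> k h B Kk kh HB.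
  have k0 : 0 <= k by rewrite (le_trans _ Kk)// (le_trans ler01).
  have te := weak_solution_trunc_energy mO wu f_cont k0 kh (fun t => fK k t Kk) HB.
  have mv : measurable_fun setT (trunc k h \o u).
    by apply: measurableT_comp => //; exact: measurable_trunc.
  have := energy u (gagliardo s u (trunc k h \o u)) k h _ mu
    (measurable_gagliardo _ mu mv)
    (fun z => gagliardo_homo_ge0 s u z (trunc_homo kh)) _ kh
    (superlevel_fin mO mu finO k) (am k Kk).
  set A := fine _; set G := integral _ _ _ => H.
  have {}H : (((h - k) ^+ 2)%:E * lebesgueN (superlevel Omega u h) <=
      (C * A `^ (2 * s / N%:R))%:E * G)%E.
    apply: H => x y hx ky; rewrite /gagliardo/= ler_wpM2r ?invr_ge0 ?powR_ge0//.
    case: (truncP (u x) kh) => [[? _]|[? ? _]|[_ ->]]; [lra|lra|].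
    case: (truncP (u y) kh) => [[_ ->]|[? _ _]|[? _]]; [|lra|lra].
    nra.
  have hk : 0 < h - k by rewrite subr_gt0.
  have CA : 0 <= C * A `^ (2 * s / N%:R) by rewrite mulr_ge0 ?powR_ge0// ltW.
  have : (c%:E * (((h - k) ^+ 2)%:E * lebesgueN (superlevel Omega u h)) <=
      (C * A `^ (2 * s / N%:R))%:E * ((h - k) * B)%:E)%E.
    apply: (@le_trans _ _ (c%:E * ((C * A `^ (2 * s / N%:R))%:E * G))%E).
      by rewrite lee_wpmul2l// lee_fin ltW.
    by rewrite muleCA lee_wpmul2l// lee_fin.
  rewrite superlevel_fin// -!EFinM !lee_fin => H3.
  rewrite -(ler_pM2l (mulr_gt0 c0 hk)); apply: le_trans (le_trans _ H3) _.
    by rewrite le_eqVlt; apply/orP; left; apply/eqP; ring.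
  rewrite le_eqVlt; apply/orP; left; apply/eqP; field.
  by rewrite gt_eqF.
Qed.
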